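(* Let $n(r)$ be the number of zeroes of the planar Gaussian analytic function $\mathbf{g}$ in the disk of radius $r$ around $0$. Fix $\alpha>2$ and $\gamma>0$. Then, as $r\to\infty$, $$\mathbf{P}\left[n(r)\ge r^2+\gamma r^{\alpha}\right]=e^{-\left(\frac{\alpha}{2}-1\right)\gamma^2 r^{2\alpha}\log r\,(1+o(1))}.$$
   Context: A standard complex normal random variable has density $\frac1\pi e^{-|z|^2}$ on $\mathbb{C}$. The planar Gaussian analytic function is the random entire function $\mathbf{g}(z)=\sum_{n=0}^{\infty}\frac{a_n z^n}{\sqrt{n!}}$, where $a_n$, $n\ge 0$, are i.i.d. standard complex normal random variables. *)

(* Defs.v *)
From HB Require Import structures.
From mathcomp Require Import all_boot all_order all_algebra.
From mathcomp Require Export complex.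
From mathcomp Require Import all_classical all_reals all_analysis.
Import Order.TTheory GRing.Theory Num.Theory.
Import numFieldNormedType.Exports.

Set Implicit Arguments.
Unset Strict Implicit.
Unset Printing Implicit Defensive.

Local Open Scope classical_set_scope.
Local Open Scope ring_scope.
Local Open Scope complex_scope.

(* R[i] carries no measurable structure in the library: the Borel sets of C are
   the preimages under this map of the measurable subsets of the plane. *)
Definition to_plane (R : realType) (z : R[i]) :
  measurableTypeR R * measurableTypeR R := (complex.Re z, complex.Im z).

Definition std_complex_normal_pdf (R : realType)
    (p : measurableTypeR R * measurableTypeR R) : R :=
  pi^-1 * expR (- (p.1 ^+ 2 + p.2 ^+ 2)).

Definition std_complex_normal (R : realType) (d : measure_display)
    (T : measurableType d) (P : probability T R) (X : T -> R[i]) : Prop :=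
  measurable_fun [set: T] (fun w => to_plane (X w)) /\
  forall A : set (measurableTypeR R * measurableTypeR R), measurable A ->
    P [set w | A (to_plane (X w))] =
    (\int[@lebesgue_measure R \x @lebesgue_measure R]_(p in A)
       (std_complex_normal_pdf p)%:E)%E.

Definition mutually_independent (R : realType) (d : measure_display)
    (T : measurableType d) (P : probability T R) (X : nat -> T -> R[i]) : Prop :=
  forall (s : seq nat) (A : nat -> set (measurableTypeR R * measurableTypeR R)),
    uniq s -> (forall n, measurable (A n)) ->
    P (\bigcap_(n in [set` s]) [set w | A n (to_plane (X n w))]) =
    (\prod_(n <- s) P [set w | A n (to_plane (X n w))])%E.

Definition planar_terms (R : realType) (c : nat -> R[i]) (z : R[i]) :
    nat -> R[i]^o :=
  fun n => c n * z ^+ n / (Num.sqrt n`!%:R)%:C.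

(* For i.i.d. standard complex normal coefficients the series almost surely
   converges on all of C; on the exceptional null event the function is set to
   0, so that it is entire for every outcome. *)
Definition planar_gaf (R : realType) (c : nat -> R[i]) (z : R[i]) : R[i]^o :=
  if `[< forall y : R[i], cvgn (series (planar_terms c y)) >]
  then limn (series (planar_terms c z)) else 0.

(* Order of vanishing of f at z, by complex derivatives: 0 when f z != 0, and
   +oo when all derivatives vanish. *)
Definition zero_mult (R : realType) (f : R[i] -> R[i]^o) (z : R[i]) : \bar R :=
  ereal_sup [set (k%:R)%:E | k in
    [set k : nat | forall j : nat, (j < k)%N -> derive1n j f z = 0]].

(* Zeros in the open disk of radius r around 0, counted with multiplicity. *)
Definition zero_count (R : realType) (f : R[i] -> R[i]^o) (r : R) : \bar R :=
  (\esum_(z in [set z : R[i] | (`|z| < r%:C)%R]) zero_mult f z)%E.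

(* Main.v *)
Require Import Defs.
From HB Require Import structures.
From mathcomp Require Import all_boot all_order all_algebra.
From mathcomp Require Import all_classical all_reals all_analysis.
From mathcomp Require Import measurable_realfun zify ring lra.
Import Order.TTheory GRing.Theory Num.Theory.
Import numFieldNormedType.Exports.

(** Let N be the least integer that is at least r^2 + gamma r^alpha, and let
    L = ln (N / r^2), which tends to infinity because alpha > 2. Having N zeros
    in the disk of radius r is, up to factors e^O(N) on each coefficient, the
    same as having |a_n| <= (r / sqrt N)^(N - n) for every n < N. A standard
    complex normal variable is smaller than t with probability of order t^2,
    so by independence the probability is exp (- N^2 L / 2 + O(N^2)). Since
    N ~ gamma r^alpha and L ~ (alpha - 2) ln r, this is the announced rate.

    Upper bound. Zeros w_1, ..., w_N are divided out one after the other.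
    Dividing a power series with |c_n| s^n <= M by X - w, with |w| < r < s,
    only replaces M by M / (s - r), as the geometric formula for the
    coefficients of the quotient shows. Multiplying the last quotient again by
    the N linear factors gives |c_n| <= M 2^N r^(N - n) / (s - r)^N for n < N
    ([has_zeros_coef_le]). Here c_n = a_n / sqrt n!, s = sqrt N, and M = e^(3N)
    works unless some |a_n| exceeds e^N 2^n, an event of probability at most
    4 exp (- e^(2N) / 2) ([overcrowded_coef_le]).

    Lower bound. If on a circle the term of index N is larger than the sum of
    all the others, there are at least N zeros inside ([dominant_has_zeros]).
    For a polynomial f this has an algebraic proof: dominance says that
    multiplication by f followed by forgetting the coefficients below N is
    bounded below in a weighted l1 norm; this survives the removal of a root
    outside the circle, the inverse of the corresponding factor being a limit
    of polynomials, and a product of linear factors that has this property has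
    degree at least N. On the circle of radius r / 2 dominance follows from
    |a_n| <= (r / (2 sqrt N))^(N - n) / (16 N) for n < N, |a_N| > 1/4 and a mild
    growth condition for n > N ([coef_box_has_zeros]).

    Having N zeros is not visibly a measurable condition on the coefficients,
    since it quantifies over points of the plane. It is replaced by having
    eps-approximate zeros among the rational points for every eps > 0.
    The two agree because evaluation and division by X - w are Lipschitz in w,
    and because bounded sequences of points have cluster points
    ([near_zeros_closed]). The same compactness argument carries the
    polynomial case of the dominance criterion over to power series.

    Counting zeros with the multiplicities read off the derivatives amounts to
    repeated division: if f = (X - w) g, the order of vanishing at w drops by
    one from f to g and is unchanged elsewhere ([zero_count_geP]). *)

Set Implicit Arguments.
Unset Strict Implicit.
Unset Printing Implicit Defensive.

Local Open Scope classical_set_scope.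
Local Open Scope ring_scope.
Local Open Scope complex_scope.

(** * Complex series with geometric decay *)
Section ComplexSeries.
Variable R : realType.
Implicit Types (z w : R[i]) (u v : nat -> R[i]) (q M : R).

(** The modulus as an element of [R]; the norm of [R[i]] is [R[i]]-valued. *)
Definition nrm z : R := complex.Re `|z|.

Lemma nrmE z : `|z| = (nrm z)%:C.
Proof. by rewrite /nrm normc_def. Qed.

Lemma nrm_ge0 z : 0 <= nrm z.
Proof. by rewrite /nrm normc_def /= sqrtr_ge0. Qed.

Lemma nrm0 : nrm 0 = 0. Proof. by rewrite /nrm normr0. Qed.
Lemma nrm1 : nrm 1 = 1. Proof. by rewrite /nrm normr1. Qed.

Lemma nrmM z w : nrm (z * w) = nrm z * nrm w.
Proof. by apply: complexI; rewrite rmorphM -!nrmE normrM. Qed.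

Lemma nrmX z n : nrm (z ^+ n) = nrm z ^+ n.
Proof. by apply: complexI; rewrite rmorphXn -!nrmE normrX. Qed.

Lemma nrmN z : nrm (- z) = nrm z.
Proof. by apply: complexI; rewrite -!nrmE normrN. Qed.

Lemma nrmV z : nrm z^-1 = (nrm z)^-1.
Proof. by apply: complexI; rewrite -nrmE normfV nrmE fmorphV. Qed.

Lemma nrmR (x : R) : nrm x%:C = `|x|.
Proof. by rewrite /nrm normc_def /= expr0n addr0 sqrtr_sqr. Qed.

Lemma nrm_nat n : nrm (n%:R : R[i]) = n%:R.
Proof.
have -> : (n%:R : R[i]) = (n%:R : R)%:C by rewrite rmorph_nat.
by rewrite nrmR ger0_norm.
Qed.

Lemma nrmB z w : nrm (z - w) = nrm (w - z).
Proof. by rewrite -nrmN opprB. Qed.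

Lemma ler_nrmD z w : nrm (z + w) <= nrm z + nrm w.
Proof. by rewrite -lecR rmorphD -!nrmE ler_normD. Qed.

Lemma ler_nrmB z w : nrm (z - w) <= nrm z + nrm w.
Proof. by rewrite -[nrm w]nrmN ler_nrmD. Qed.

Lemma nrm_eq0 z : (nrm z == 0) = (z == 0).
Proof. by rewrite -(inj_eq (@complexI R)) -nrmE normr_eq0. Qed.

Lemma ler_nrm_sum (I : Type) (s : seq I) (Q : pred I) (F : I -> R[i]) :
  nrm (\sum_(i <- s | Q i) F i) <= \sum_(i <- s | Q i) nrm (F i).
Proof.
elim/big_ind2 : _ => [|x1 x2 y1 y2 h1 h2|//]; first by rewrite nrm0.
by rewrite (le_trans (ler_nrmD _ _))// lerD.
Qed.

Lemma nrm_ltc z (r : R) : (`|z| < r%:C) = (nrm z < r).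
Proof. by rewrite nrmE ltcR. Qed.

Lemma sqr_nrm (z : R[i]) : nrm z ^+ 2 = complex.Re z ^+ 2 + complex.Im z ^+ 2.
Proof. by rewrite /nrm normc_def /= sqr_sqrtr// addr_ge0 ?sqr_ge0. Qed.

Lemma Re_le_nrm z : `|complex.Re z| <= nrm z.
Proof.
rewrite /nrm normc_def /= -[leLHS]sqrtr_sqr ler_sqrt ?lerDl ?sqr_ge0 //.
by rewrite addr_ge0 ?sqr_ge0.
Qed.

Lemma Im_le_nrm z : `|complex.Im z| <= nrm z.
Proof.
rewrite /nrm normc_def /= -[leLHS]sqrtr_sqr ler_sqrt ?lerDr ?sqr_ge0 //.
by rewrite addr_ge0 ?sqr_ge0.
Qed.

Lemma nrm_le_ReIm z : nrm z <= `|complex.Re z| + `|complex.Im z|.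
Proof.
case: z => a b; have -> : a +i* b = a%:C + 'i%C * b%:C :> R[i].
  by rewrite [LHS]complexE.
rewrite (le_trans (ler_nrmD _ _))// nrmM !nrmR /=.
have -> : nrm ('i%C : R[i]) = 1.
  by rewrite /nrm normc_def /= expr0n expr1n add0r sqrtr1.
by rewrite !mul1r !mul0r !subr0 !add0r !addr0.
Qed.

Lemma cvgC_nrm (F : set_system nat) {FF : Filter F} u (l : R[i]) :
  nrm (u n - l) @[n --> F] --> (0 : R) <-> u @ F --> (l : R[i]^o).
Proof.
split => [h|h].
  apply/(@cvgrPdist_lt R[i] R[i]^o) => /= e e0.
  have eR : e = (complex.Re e)%:C by rewrite RRe_real // gtr0_real.
  have e0' : 0 < complex.Re e by rewrite -ltcR -eR.
  move/cvgrPdist_lt : h => /(_ _ e0'); apply: filterS => n /=.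
  rewrite sub0r normrN ger0_norm ?nrm_ge0// => hn.
  by rewrite eR distrC nrm_ltc.
apply/cvgrPdist_lt => /= e e0.
have e0' : 0 < e%:C by rewrite ltcR.
move/(@cvgrPdist_lt R[i] R[i]^o) : h => /(_ _ e0'); apply: filterS => n /=.
by move=> h; rewrite sub0r normrN ger0_norm ?nrm_ge0// nrmB -nrm_ltc.
Qed.

Lemma cvgC_ReIm u (a b : R) :
  complex.Re (u n) @[n --> \oo] --> a -> complex.Im (u n) @[n --> \oo] --> b ->
  u @ \oo --> ((a +i* b : R[i]) : R[i]^o).
Proof.
move=> ha hb; apply/cvgC_nrm.
apply: (@squeeze_cvgr _ _ _ _ (cst 0)
  (fun n => `|complex.Re (u n) - a| + `|complex.Im (u n) - b|)).
- near=> n; rewrite nrm_ge0 /= (le_trans (nrm_le_ReIm _))//.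
  by case: (u n).
- exact: cvg_cst.
- rewrite -(addr0 0); apply: cvgD.
  + by apply/norm_cvg0P; apply/subr_cvg0.
  + by apply/norm_cvg0P; apply/subr_cvg0.
Unshelve. all: by end_near. Qed.

Lemma ReD z w : complex.Re (z + w) = complex.Re z + complex.Re w.
Proof. by case: z; case: w. Qed.
Lemma ImD z w : complex.Im (z + w) = complex.Im z + complex.Im w.
Proof. by case: z; case: w. Qed.

Lemma Re_series u n :
  complex.Re (series u n) = series (fun k => complex.Re (u k)) n.
Proof.
rewrite /series /=; elim: n => [|n IH]; first by rewrite !big_geq.
by rewrite !big_nat_recr//= ReD IH.
Qed.
Lemma Im_series u n :
  complex.Im (series u n) = series (fun k => complex.Im (u k)) n.
Proof.
rewrite /series /=; elim: n => [|n IH]; first by rewrite !big_geq.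
by rewrite !big_nat_recr//= ImD IH.
Qed.

Lemma geo_series_le (q : R) n : 0 <= q < 1 ->
  \sum_(0 <= k < n) q ^+ k <= (1 - q)^-1.
Proof.
move=> /andP[q0 q1]; have q1' : 0 < 1 - q by rewrite subr_gt0.
rewrite -[leRHS]mul1r ler_pdivlMr// big_mkord mulrC.
have -> : (1 - q) * \sum_(i < n) q ^+ i = 1 - q ^+ n.
  by rewrite -[1 - q ^+ n]opprB subrX1 -mulNr opprB.
by rewrite lerBlDr lerDl exprn_ge0.
Qed.

Lemma nrm_lim_le u (l : R[i]) (B : R) : u @ \oo --> (l : R[i]^o) ->
  (forall n, nrm (u n) <= B) -> nrm l <= B.
Proof.
move=> /cvgC_nrm ul uB.
have h : (fun n => nrm (u n - l) + B) @ \oo --> (0 + B : R).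
  by apply: cvgD => //; exact: cvg_cst.
rewrite -[leRHS]add0r -(cvg_lim _ h)//; apply: limr_ge; first by apply/cvg_ex; exists (0 + B).
near=> n; rewrite -{1}[l](subKr (u n)).
by rewrite (le_trans (ler_nrmB _ _))// addrC lerD2l uB.
Unshelve. all: by end_near. Qed.

Definition geo_bounded q M u := forall n, nrm (u n) <= M * q ^+ n.

Lemma geo_bounded_ge0 q M u : geo_bounded q M u -> 0 <= M.
Proof. by move=> /(_ 0%N); rewrite expr0 mulr1; apply: le_trans; exact: nrm_ge0. Qed.

(** [R[i]] is complete because its real and imaginary parts are: both real
    series converge absolutely by comparison with a geometric one. *)
Lemma geo_bounded_cvg q M u : 0 <= q < 1 -> geo_bounded q M u ->
  cvgn (series u : nat -> R[i]^o).
Proof.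
move=> /andP[q0 q1] uM.
have M0 := geo_bounded_ge0 uM.
have h (f : R[i] -> R) : (forall z, `|f z| <= nrm z) ->
    cvgn (series (fun n => f (u n))).
  move=> fz; apply: normed_cvg; apply: (@series_le_cvg _ _ (geometric M q)) => /=.
  - by move=> n; rewrite normr_ge0.
  - by move=> n; rewrite mulr_ge0// exprn_ge0.
  - by move=> n; rewrite (le_trans (fz _)).
  - by apply: is_cvg_geometric_series; rewrite ger0_norm.
apply/cvg_ex; exists (limn (series (fun n => complex.Re (u n)))
   +i* limn (series (fun n => complex.Im (u n)))).
apply: cvgC_ReIm.
- under eq_fun do rewrite Re_series; exact: (h _ Re_le_nrm).
- under eq_fun do rewrite Im_series; exact: (h _ Im_le_nrm).
Qed.

Definition csum u : R[i] := limn (series u : nat -> R[i]^o).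

Lemma csum_cvg q M u : 0 <= q < 1 -> geo_bounded q M u ->
  series u @ \oo --> (csum u : R[i]^o).
Proof. by move=> q01 /(geo_bounded_cvg q01). Qed.

Lemma cvg_csum u (l : R[i]) : series u @ \oo --> (l : R[i]^o) -> csum u = l.
Proof. by move=> h; apply: (cvg_lim (@norm_hausdorff _ R[i]^o) h). Qed.

Lemma nrm_csum q M u : 0 <= q < 1 -> geo_bounded q M u -> nrm (csum u) <= M / (1 - q).
Proof.
move=> q01 uM; apply: (nrm_lim_le (csum_cvg q01 uM)) => n.
rewrite /series /= (le_trans (ler_nrm_sum _ _ _))//.
apply: (@le_trans _ _ (\sum_(0 <= k < n) M * q ^+ k)).
  by apply: ler_sum => k _; exact: uM.
by rewrite -mulr_sumr ler_wpM2l ?(geo_bounded_ge0 uM)// geo_series_le.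
Qed.

Lemma csumD q M M' u v : 0 <= q < 1 -> geo_bounded q M u -> geo_bounded q M' v ->
  csum (fun n => u n + v n) = csum u + csum v.
Proof.
move=> q01 uM vM; apply: cvg_csum.
have -> : series (fun n => u n + v n) = (series u : nat -> R[i]^o) \+ series v.
  by apply/funext => n; rewrite /series /= big_split.
by apply: (@cvgD R[i] R[i]^o); [exact: csum_cvg q01 uM|exact: csum_cvg q01 vM].
Qed.

Lemma csumZ q M u a : 0 <= q < 1 -> geo_bounded q M u ->
  csum (fun n => a * u n) = a * csum u.
Proof.
move=> q01 uM; apply: cvg_csum.
have -> : series (fun n => a * u n) = (fun n => a * series u n).
  by apply/funext => n; rewrite /series /= mulr_sumr.
apply: (@cvgMr R[i] _ _ _ (series u) a (csum u)); exact: csum_cvg q01 uM.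
Qed.

Lemma csumS q M u : 0 <= q < 1 -> geo_bounded q M u ->
  csum u = u 0%N + csum (fun n => u n.+1).
Proof.
move=> q01 uM; have /cvgC_nrm := csum_cvg q01 uM; rewrite -cvg_shiftS => h.
have -> : csum u = u 0%N + (csum u - u 0%N) by rewrite addrC subrK.
congr (_ + _); apply/esym/cvg_csum/cvgC_nrm; apply: cvg_trans h.
apply: near_eq_cvg; near=> n; rewrite /= /series /= [in LHS]big_nat_recl//=.
by congr nrm; ring.
Unshelve. all: by end_near. Qed.

Lemma csum0 : csum (fun=> 0 : R[i]) = 0.
Proof.
apply: cvg_csum; have -> : series (fun=> 0 : R[i]) = (fun=> 0 : R[i]).
  by apply/funext => n; rewrite /series /= big1.
exact: (@cvg_cst R[i]^o).
Qed.

End ComplexSeries.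

(** * Power series and division by a linear factor *)
Section PowerSeries.
Variable R : realType.
Implicit Types (z w v : R[i]) (c u : nat -> R[i]) (s M : R).

Definition coef_bounded s M c := forall n, nrm (c n) * s ^+ n <= M.
Definition pseval c z : R[i] := csum (fun n => c n * z ^+ n).
(** The coefficients of (f - f(w)) / (X - w), where f is the power series with
    coefficients c: the quotient exists whether or not w is a zero of f. *)
Definition psquot w c : nat -> R[i] := fun k => csum (fun j => c (k + j).+1 * w ^+ j).
Definition mulXsub w u : nat -> R[i] :=
  fun n => (if n is m.+1 then u m else 0) - w * u n.

Lemma ratio_itv s w : nrm w < s -> 0 <= nrm w / s < 1.
Proof.
move=> ws; have s0 : 0 < s := le_lt_trans (nrm_ge0 w) ws.
by rewrite divr_ge0 ?nrm_ge0 ?(ltW s0)//= ltr_pdivrMr// mul1r.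
Qed.

Lemma coef_bounded_ge0 s M c : coef_bounded s M c -> 0 <= M.
Proof. by move=> /(_ 0%N); rewrite expr0 mulr1; apply: le_trans; exact: nrm_ge0. Qed.

Lemma geo_bounded_shift s M c w k : nrm w < s -> coef_bounded s M c ->
  geo_bounded (nrm w / s) (M / s ^+ k) (fun j => c (k + j)%N * w ^+ j).
Proof.
move=> ws cM j; have s0 : 0 < s := le_lt_trans (nrm_ge0 w) ws.
rewrite nrmM nrmX expr_div_n mulrACA -invfM -exprD mulrAC ler_wpM2r//.
  by rewrite exprn_ge0 ?nrm_ge0.
by rewrite ler_pdivlMr ?exprn_gt0.
Qed.

Lemma geo_bounded_pseval s M c w : nrm w < s -> coef_bounded s M c ->
  geo_bounded (nrm w / s) M (fun n => c n * w ^+ n).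
Proof. by move=> ws /(geo_bounded_shift 0 ws); rewrite expr0 divr1. Qed.

Lemma geo_bounded_psquot s M c w k : nrm w < s -> coef_bounded s M c ->
  geo_bounded (nrm w / s) (M / s ^+ k.+1) (fun j => c (k + j).+1 * w ^+ j).
Proof. by move=> ws /(geo_bounded_shift k.+1 ws). Qed.

Lemma nrm_pseval s M c w : nrm w < s -> coef_bounded s M c ->
  nrm (pseval c w) <= M * s / (s - nrm w).
Proof.
move=> ws cM; have s0 : 0 < s := le_lt_trans (nrm_ge0 w) ws.
apply: le_trans (nrm_csum (ratio_itv ws) (geo_bounded_pseval ws cM)) _.
rewrite le_eqVlt; apply/orP; left; apply/eqP; field.
by rewrite !gt_eqF// subr_gt0.
Qed.

Lemma coef_bounded_psquot s M c w : nrm w < s -> coef_bounded s M c ->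
  coef_bounded s (M / (s - nrm w)) (psquot w c).
Proof.
move=> ws cM k; have s0 : 0 < s := le_lt_trans (nrm_ge0 w) ws.
have h := nrm_csum (ratio_itv ws) (geo_bounded_psquot k ws cM).
apply: le_trans (ler_wpM2r _ h) _; first by rewrite exprn_ge0 // ltW.
rewrite le_eqVlt; apply/orP; left; apply/eqP; rewrite exprS; field.
by rewrite !gt_eqF ?exprn_gt0// subr_gt0.
Qed.

Lemma pseval_psquot s M c w : nrm w < s -> coef_bounded s M c ->
  pseval c w = c 0%N + w * psquot w c 0%N.
Proof.
move=> ws cM; rewrite /pseval (csumS (ratio_itv ws) (geo_bounded_pseval ws cM)) expr0 mulr1.
rewrite /psquot -(csumZ w (ratio_itv ws) (geo_bounded_psquot 0 ws cM)); congr (_ + csum _).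
by apply/funext => n; rewrite add0n exprS; ring.
Qed.

Lemma psquotS s M c w k : nrm w < s -> coef_bounded s M c ->
  psquot w c k = c k.+1 + w * psquot w c k.+1.
Proof.
move=> ws cM; rewrite {1}/psquot (csumS (ratio_itv ws) (geo_bounded_psquot k ws cM)).
rewrite addn0 expr0 mulr1.
rewrite /psquot -(csumZ w (ratio_itv ws) (geo_bounded_psquot k.+1 ws cM)); congr (_ + csum _).
by apply/funext => n; rewrite addnS addSn exprS; ring.
Qed.

Lemma coef_boundedD s M M' c u :
  coef_bounded s M c -> coef_bounded s M' u -> coef_bounded s (M + M') (c \+ u).
Proof.
move=> cM uM n; have [s0|s0] := leP 0 (s ^+ n).
  rewrite (le_trans (ler_wpM2r s0 (ler_nrmD _ _)))// mulrDl lerD//.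
rewrite (@le_trans _ _ 0)// ?addr_ge0 ?(coef_bounded_ge0 cM) ?(coef_bounded_ge0 uM)//.
by rewrite mulr_ge0_le0 ?nrm_ge0 ?ltW.
Qed.

Lemma coef_boundedZ s M c a :
  coef_bounded s M c -> coef_bounded s (nrm a * M) (fun n => a * c n).
Proof. by move=> cM n; rewrite nrmM -mulrA ler_wpM2l ?nrm_ge0. Qed.

Lemma psevalD s M M' c u w : nrm w < s -> coef_bounded s M c -> coef_bounded s M' u ->
  pseval (c \+ u) w = pseval c w + pseval u w.
Proof.
move=> ws cM uM.
rewrite /pseval -(csumD (ratio_itv ws) (geo_bounded_pseval ws cM) (geo_bounded_pseval ws uM)).
by congr csum; apply/funext => n /=; rewrite mulrDl.
Qed.

Lemma psevalZ s M c a w : nrm w < s -> coef_bounded s M c ->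
  pseval (fun n => a * c n) w = a * pseval c w.
Proof.
move=> ws cM; rewrite /pseval -(csumZ a (ratio_itv ws) (geo_bounded_pseval ws cM)).
by congr csum; apply/funext => n /=; rewrite mulrA.
Qed.

Lemma psquotD s M M' c u w : nrm w < s -> coef_bounded s M c -> coef_bounded s M' u ->
  psquot w (c \+ u) = psquot w c \+ psquot w u.
Proof.
move=> ws cM uM; apply/funext => k /=.
rewrite /psquot -(csumD (ratio_itv ws) (geo_bounded_psquot k ws cM) (geo_bounded_psquot k ws uM)).
by congr csum; apply/funext => n /=; rewrite mulrDl.
Qed.

Lemma psquotZ s M c a w : nrm w < s -> coef_bounded s M c ->
  psquot w (fun n => a * c n) = (fun n => a * psquot w c n).
Proof.
move=> ws cM; apply/funext => k /=.
rewrite /psquot -(csumZ a (ratio_itv ws) (geo_bounded_psquot k ws cM)).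
by congr csum; apply/funext => n /=; rewrite mulrA.
Qed.

Lemma coef_bounded_shift s M u : 0 <= s -> coef_bounded s M u ->
  coef_bounded s (s * M) (fun n => if n is m.+1 then u m else 0).
Proof.
move=> s0 uM [|n]; first by rewrite nrm0 mul0r mulr_ge0 ?(coef_bounded_ge0 uM).
by rewrite exprS mulrCA ler_wpM2l.
Qed.

Lemma mulXsubE w u :
  mulXsub w u = (fun n => if n is m.+1 then u m else 0) \+ (fun n => - w * u n).
Proof. by apply/funext => n; rewrite /mulXsub /= mulNr. Qed.

Lemma coef_bounded_mulXsub s M u w : 0 <= s -> coef_bounded s M u ->
  coef_bounded s (s * M + nrm w * M) (mulXsub w u).
Proof.
move=> s0 uM; rewrite mulXsubE -[nrm w]nrmN.
by apply: coef_boundedD; [exact: coef_bounded_shift|exact: coef_boundedZ].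
Qed.

Lemma pseval_mulXsub s M u w z : nrm z < s -> coef_bounded s M u ->
  pseval (mulXsub w u) z = (z - w) * pseval u z.
Proof.
move=> zs uM; have s0 : 0 <= s := le_trans (nrm_ge0 z) (ltW zs).
have sM := coef_bounded_shift s0 uM.
rewrite mulXsubE (psevalD zs sM (coef_boundedZ (- w) uM)) (psevalZ (- w) zs uM) mulrDl.
congr (_ + _); rewrite /pseval (csumS (ratio_itv zs) (geo_bounded_pseval zs sM)) mul0r add0r.
rewrite -(csumZ z (ratio_itv zs) (geo_bounded_pseval zs uM)); congr csum.
by apply/funext => n; rewrite exprS; ring.
Qed.

(** The sum that defines the quotient telescopes. *)
Lemma psquot_mulXsub s M u w :
  nrm w < s -> coef_bounded s M u -> psquot w (mulXsub w u) = u.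
Proof.
move=> ws uM; have s0 : 0 <= s := le_trans (nrm_ge0 w) (ltW ws).
apply/funext => k.
have h1 := geo_bounded_shift k ws uM; have h2 := geo_bounded_shift k.+1 ws uM.
rewrite mulXsubE (psquotD ws (coef_bounded_shift s0 uM) (coef_boundedZ (- w) uM)) /= (psquotZ (- w) ws uM).
rewrite /psquot /= [csum _](csumS (ratio_itv ws) h1) addn0 expr0 mulr1 -addrA.
rewrite -(csumZ (- w) (ratio_itv ws) h2) -[RHS]addr0; congr (_ + _).
have h3 : geo_bounded (nrm w / s) (M / s ^+ k * (nrm w / s))
    (fun n => u (k + n.+1)%N * w ^+ n.+1).
  by move=> n; rewrite -mulrA -exprS; exact: h1.
have h4 : geo_bounded (nrm w / s) (nrm w * (M / s ^+ k.+1))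
    (fun n => - w * (u (k.+1 + n)%N * w ^+ n)).
  by move=> n; rewrite nrmM nrmN -mulrA ler_wpM2l ?nrm_ge0.
rewrite -(csumD (ratio_itv ws) h3 h4) -[RHS]csum0; congr csum.
by apply/funext => n; rewrite addSnnS exprS; ring.
Qed.

Lemma psquot_decomp s M c w : nrm w < s -> coef_bounded s M c ->
  c = (fun n => if n is 0%N then pseval c w else 0) \+ mulXsub w (psquot w c).
Proof.
move=> ws cM; apply/funext => -[|n] /=; rewrite /mulXsub.
  by rewrite (pseval_psquot ws cM) sub0r addrK.
by rewrite (psquotS n ws cM) add0r addrK.
Qed.

Lemma coef_bounded_const s a :
  coef_bounded s (nrm a) (fun n => if n is 0%N then a else 0).
Proof. by move=> [|n]; rewrite ?expr0 ?mulr1// nrm0 mul0r nrm_ge0. Qed.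

Lemma pseval_const a z : pseval (fun n => if n is 0%N then a else 0) z = a.
Proof.
have zs : nrm z < nrm z + 1 by rewrite ltrDl.
rewrite (pseval_psquot zs (coef_bounded_const (nrm z + 1) a)) /psquot.
rewrite (_ : (fun j => _) = (fun=> 0)) ?csum0 ?mulr0 ?addr0//.
by apply/funext => n; rewrite mul0r.
Qed.

Lemma psquot_const a w : psquot w (fun n => if n is 0%N then a else 0) = (fun=> 0).
Proof.
apply/funext => k; rewrite /psquot -[RHS]csum0; congr csum.
by apply/funext => n; rewrite mul0r.
Qed.

Lemma pseval_sub s M c w z : nrm w < s -> nrm z < s -> coef_bounded s M c ->
  pseval c z = pseval c w + (z - w) * pseval (psquot w c) z.
Proof.
move=> ws zs cM; have s0 : 0 <= s := le_trans (nrm_ge0 w) (ltW ws).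
have dM := coef_bounded_psquot ws cM.
rewrite {1}(psquot_decomp ws cM) (psevalD zs (coef_bounded_const _ _) (coef_bounded_mulXsub w s0 dM)).
by rewrite pseval_const (pseval_mulXsub w zs dM).
Qed.

(** The maps [psquot w] satisfy the resolvent identity of the operators
    1 / (X - w); this is what makes them Lipschitz in w. *)
Lemma psquot_resolvent s M c v w : nrm v < s -> nrm w < s -> coef_bounded s M c ->
  psquot w c = psquot v c \+ (fun n => (w - v) * psquot w (psquot v c) n).
Proof.
move=> vs ws cM; have s0 : 0 <= s := le_trans (nrm_ge0 w) (ltW ws).
have dM := coef_bounded_psquot vs cM.
rewrite {1}(psquot_decomp vs cM) (psquotD ws (coef_bounded_const _ _) (coef_bounded_mulXsub v s0 dM)).
rewrite psquot_const.
have -> : mulXsub v (psquot v c) = mulXsub w (psquot v c) \+ (fun n => (w - v) * psquot v c n).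
  by apply/funext => n; rewrite /mulXsub /=; ring.
rewrite (psquotD ws (coef_bounded_mulXsub w s0 dM) (coef_boundedZ _ dM)) (psquot_mulXsub ws dM) (psquotZ _ ws dM).
by apply/funext => n /=; rewrite add0r.
Qed.

Lemma coef_bounded_psquotB s M c v w : nrm v < s -> nrm w < s -> coef_bounded s M c ->
  coef_bounded s (nrm (w - v) * (M / (s - nrm v) / (s - nrm w)))
    (fun n => psquot w c n - psquot v c n).
Proof.
move=> vs ws cM.
have -> : (fun n => psquot w c n - psquot v c n) = (fun n => (w - v) * psquot w (psquot v c) n).
  by apply/funext => n; rewrite {1}(psquot_resolvent vs ws cM) /= addrAC subrr add0r.
by apply: coef_boundedZ; do 2?apply: coef_bounded_psquot.
Qed.

Lemma coef_bounded_mono s s' M c :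
  0 <= s -> s <= s' -> coef_bounded s' M c -> coef_bounded s M c.
Proof.
move=> s0 ss' cM n; apply: le_trans (cM n); rewrite ler_wpM2l ?nrm_ge0//.
by rewrite lerXn2r// ?nnegrE// (le_trans s0).
Qed.

Definition entire c := forall s, 0 < s -> exists M, coef_bounded s M c.

Lemma entire_psquot c w : entire c -> entire (psquot w c).
Proof.
move=> ce s s0; have w0 := nrm_ge0 w.
have [|M cM] := ce (nrm w + s); first by lra.
exists (M / (nrm w + s - nrm w)).
apply: (coef_bounded_mono (ltW s0) _ (coef_bounded_psquot _ cM)); lra.
Qed.

(** * Multiplicities and the zero count *)
Definition psderiv c : nat -> R[i] := fun n => n.+1%:R * c n.+1.

Lemma entire_psderiv c : entire c -> entire (psderiv c).
Proof.
move=> ce s s0; have [|M cM] := ce (2 * s); first by lra.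
exists (M / s) => n; rewrite nrmM nrm_nat.
rewrite ler_pdivlMr// -!mulrA -exprSr.
apply: le_trans (cM n.+1); rewrite exprMn mulrCA mulrC -mulrA.
rewrite [leRHS]mulrC -[leRHS]mulrA ler_wpM2r//.
  by rewrite mulr_ge0 ?nrm_ge0 ?exprn_ge0 ?(ltW s0).
by rewrite -natrX ler_nat ltnW// ltn_expl.
Qed.

Lemma entire_iter_psderiv c j : entire c -> entire (iter j psderiv c).
Proof. by move=> ce; elim: j => //= j; exact: entire_psderiv. Qed.

Lemma psderiv_mulXsub w u : psderiv (mulXsub w u) = u \+ mulXsub w (psderiv u).
Proof.
apply/funext => -[|n]; rewrite /psderiv /mulXsub /=; first by ring.
by rewrite -[n.+2%:R]natr1; ring.
Qed.

Lemma iter_psderiv_mulXsub w u j : iter j psderiv (mulXsub w u) =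
  mulXsub w (iter j psderiv u) \+ (fun n => j%:R * iter j.-1 psderiv u n).
Proof.
elim: j => [|j IH].
  by apply/funext => n /=; rewrite mul0r addr0.
rewrite iterS IH.
have -> (a b : nat -> R[i]) : psderiv (a \+ b) = psderiv a \+ psderiv b.
  by apply/funext => n; rewrite /psderiv /= mulrDr.
rewrite psderiv_mulXsub; apply/funext => n /=.
have -> : psderiv (fun n0 => j%:R * iter j.-1 psderiv u n0) n = j%:R * iter j psderiv u n.
  case: j {IH} => [|j /=]; first by rewrite /psderiv !mul0r mulr0.
  by rewrite /psderiv mulrCA.
by rewrite -[j.+1]addn1 natrD; ring.
Qed.

Lemma entireE c s : 0 < s -> entire c -> {M | coef_bounded s M c}.
Proof. by move=> s0 /(_ _ s0) /cid. Qed.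

(** Differentiating f = f(z) + (X - z) g gives g + (X - z) g', whose value at z
    is g(z). No interchange of summations is needed. *)
Lemma pseval_psderiv c z : entire c -> pseval (psderiv c) z = pseval (psquot z c) z.
Proof.
move=> ce; have zs : nrm z < nrm z + 1 by rewrite ltrDl.
have s0 : 0 < nrm z + 1 by apply: le_lt_trans zs; exact: nrm_ge0.
have [M cM] := entireE s0 ce.
have [M' cM'] := entireE s0 (entire_psquot z ce).
have [M'' cM''] := entireE s0 (entire_psderiv (entire_psquot z ce)).
have -> : psderiv c = psderiv (mulXsub z (psquot z c)).
  by rewrite {1}(psquot_decomp zs cM); apply/funext => n; rewrite /psderiv /= add0r.
rewrite psderiv_mulXsub (psevalD zs cM' (coef_bounded_mulXsub z (ltW s0) cM'')).
by rewrite (pseval_mulXsub _ zs cM'') subrr mul0r addr0.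
Qed.

(** The difference quotient at z is the value of [psquot z c] at z + h. *)
Lemma derive1_pseval c z : entire c ->
  derive1 (pseval c : R[i] -> R[i]^o) z = pseval (psderiv c) z.
Proof.
move=> ce; rewrite pseval_psderiv// /derive1.
apply: (cvg_lim (@norm_hausdorff _ R[i]^o)).
have s0 : 0 < nrm z + 2 by have := nrm_ge0 z; lra.
have [M cM] := entireE s0 ce.
have zs : nrm z < nrm z + 2 by lra.
have [M' cM'] := entireE s0 (entire_psquot z ce).
have [M'' cM''] := entireE s0 (entire_psquot z (entire_psquot z ce)).
apply/(@cvgrPdist_lt R[i] R[i]^o) => /= e e0.
have eR : e = (complex.Re e)%:C by rewrite RRe_real // gtr0_real.
have e0' : 0 < complex.Re e by rewrite -ltcR -eR.
set K := M'' * (nrm z + 2).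
have K0 : 0 <= K by rewrite mulr_ge0 ?(coef_bounded_ge0 cM'')// ltW.
pose dl : R := Num.min 1 (complex.Re e / (K + 1)).
have dl0 : 0 < dl by rewrite lt_min ltr01 divr_gt0// ltr_wpDl.
near=> h.
have h0 : h != 0 by near: h; exact: (@nbhs_dnbhs_neq R[i]^o).
have hd : nrm h < dl.
  rewrite -nrm_ltc; near: h; apply: (@dnbhs0_lt R[i] R[i]^o); by rewrite ltcR.
have hz : nrm (h + z) < nrm z + 2.
  apply: le_lt_trans (ler_nrmD _ _) _; rewrite addrC ltrD2l.
  by apply: lt_le_trans hd _; rewrite /dl ge_min; apply/orP; left; lra.
have -> : h^-1 *: (pseval c (h + z) - pseval c z : R[i]^o) = pseval (psquot z c) (h + z).
  rewrite (pseval_sub zs hz cM) addrK (addrC (pseval c z)) addrK.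
  by rewrite /GRing.scale /= mulrA mulVf// mul1r.
rewrite eR nrm_ltc (pseval_sub zs hz cM') addrK opprD addNKr nrmN nrmM.
have hE : nrm (pseval (psquot z (psquot z c)) (h + z)) <= K.
  apply: le_trans (nrm_pseval hz cM'') _; rewrite -/K ler_pdivrMr ?subr_gt0//.
  rewrite ler_peMr//.
  have h1 : nrm h < 1 by apply: lt_le_trans hd _; rewrite /dl ge_min lexx.
  by have := ler_nrmD h z; lra.
apply: (@le_lt_trans _ _ (nrm h * (K + 1))).
  by rewrite ler_wpM2l ?nrm_ge0// (le_trans hE)// lerDl.
by rewrite -ltr_pdivlMr ?ltr_wpDl//; apply: lt_le_trans hd _; rewrite /dl ge_min lexx orbT.
Unshelve. all: by end_near. Qed.

Lemma derive1n_pseval c j : entire c ->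
  derive1n j (pseval c : R[i] -> R[i]^o) = pseval (iter j psderiv c).
Proof.
move=> ce; elim: j => // j IH; rewrite derive1nS IH.
by apply/funext => z; rewrite derive1_pseval//; exact: entire_iter_psderiv.
Qed.

Local Notation zmul c := (zero_mult (pseval c : R[i] -> R[i]^o)).

Lemma zero_multE c z : entire c -> zmul c z =
  ereal_sup [set (k%:R)%:E | k in
    [set k : nat | forall j : nat, (j < k)%N -> pseval (iter j psderiv c) z = 0]].
Proof.
move=> ce; rewrite /zero_mult; congr ereal_sup; congr image.
by apply/funext => k /=; apply/propext; split => h j /h; rewrite derive1n_pseval.
Qed.

Lemma pseval_iter_psderiv_mulXsub w u j z : entire u ->
  pseval (iter j psderiv (mulXsub w u)) z =
  (z - w) * pseval (iter j psderiv u) z + j%:R * pseval (iter j.-1 psderiv u) z.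
Proof.
move=> ue; have zs : nrm z < nrm z + 1 by rewrite ltrDl.
have s0 : 0 < nrm z + 1 by apply: le_lt_trans zs; exact: nrm_ge0.
have [M uM] := entireE s0 (entire_iter_psderiv j ue).
have [M' uM'] := entireE s0 (entire_iter_psderiv j.-1 ue).
rewrite iter_psderiv_mulXsub (psevalD zs (coef_bounded_mulXsub w (ltW s0) uM) (coef_boundedZ _ uM')).
by rewrite (pseval_mulXsub w zs uM) (psevalZ _ zs uM').
Qed.

Lemma entire_mulXsub w u : entire u -> entire (mulXsub w u).
Proof.
move=> ue s s0; have [M uM] := ue _ s0.
by exists (s * M + nrm w * M); apply: coef_bounded_mulXsub => //; exact: ltW.
Qed.

(** By the Leibniz rule the j-th derivative of (X - w) u at z is
    (z - w) u^(j)(z) + j u^(j-1)(z); away from w the first j derivatives of the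
    product vanish if and only if those of u do. *)
Lemma zero_mult_mulXsub_neq w u z : entire u -> z != w ->
  zmul (mulXsub w u) z = zmul u z.
Proof.
move=> ue zw; rewrite !zero_multE//; last exact: entire_mulXsub.
congr ereal_sup; congr image; apply/funext => k /=; apply/propext; split => h j jk.
  elim/ltn_ind: j jk => j IH jk.
  have := h _ jk; rewrite pseval_iter_psderiv_mulXsub//.
  have -> : j%:R * pseval (iter j.-1 psderiv u) z = 0.
    case: j {h} IH jk => [|j] IH jk; first by rewrite mul0r.
    by rewrite IH ?mulr0// ltnW.
  by move/eqP; rewrite addr0 mulf_eq0 subr_eq0 (negbTE zw) => /eqP.
rewrite pseval_iter_psderiv_mulXsub// h// mulr0 add0r h ?mulr0//.
by apply: leq_ltn_trans jk; exact: leq_pred.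
Qed.

(** At w the Leibniz rule leaves only the term j u^(j-1)(w). *)
Lemma zero_mult_mulXsub_eq w u : entire u ->
  zmul (mulXsub w u) w = (1 + zmul u w)%E.
Proof.
move=> ue; rewrite !zero_multE//; last exact: entire_mulXsub.
apply/eqP; rewrite eq_le; apply/andP; split.
  apply: ge_ereal_sup => _ [[|k] /= h <-].
    apply: adde_ge0 => //; apply: ereal_sup_ubound; exists 0%N => //.
  rewrite -natr1 addrC EFinD leeD2l//; apply: ereal_sup_ubound; exists k => //= j jk.
  have := h j.+1 jk; rewrite pseval_iter_psderiv_mulXsub// subrr mul0r add0r => /eqP.
  by rewrite mulf_eq0 pnatr_eq0 => /eqP.
rewrite -leeBrDl//; apply: ge_ereal_sup => _ [k h <-].
rewrite leeBrDl// -EFinD; apply: ereal_sup_ubound; exists k.+1; last first.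
  by rewrite -natr1 addrC.
move=> j jk; rewrite pseval_iter_psderiv_mulXsub// subrr mul0r add0r.
by case: j jk => [|j] jk; rewrite ?mul0r// h ?mulr0.
Qed.

Lemma zero_mult_ge0 (f : R[i] -> R[i]^o) z : (0 <= zero_mult f z)%E.
Proof. by apply: ereal_sup_ubound; exists 0%N. Qed.

Lemma zero_count_mulXsub w u (r : R) : entire u -> nrm w < r ->
  zero_count (pseval (mulXsub w u) : R[i] -> R[i]^o) r =
  (1 + zero_count (pseval u : R[i] -> R[i]^o) r)%E.
Proof.
move=> ue wr; rewrite /zero_count.
set B := [set z : R[i] | _]%R.
transitivity (\esum_(z in B)
   ((if z \in [set w] then 1 else 0) + zmul u z))%E.
  apply: eq_esum => z _; have [->|zw] := eqVneq z w.
    by rewrite mem_set// zero_mult_mulXsub_eq.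
  rewrite memNset; last exact/eqP.
  by rewrite add0e zero_mult_mulXsub_neq.
rewrite esumD; [|by move=> z _; case: ifP|by move=> z _; exact: zero_mult_ge0].
congr (_ + _)%E.
rewrite -(esum_mkcondr B [set w] (fun=> 1%E)) (_ : B `&` [set w] = [set w]) ?esum_set1//.
by apply/seteqP; split => z /=; [case|move=> ->; rewrite /B /= nrm_ltc].
Qed.

(** Zeros are found and divided out one at a time, so that a multiple zero is
    met as many times as its multiplicity. *)
Fixpoint has_zeros (N : nat) (r : R) c : Prop :=
  if N is N'.+1 then exists w, [/\ nrm w < r, pseval c w = 0 & has_zeros N' r (psquot w c)]
  else True.

Lemma mulXsub_psquot c w : entire c -> pseval c w = 0 -> c = mulXsub w (psquot w c).
Proof.
move=> ce cw; have ws : nrm w < nrm w + 1 by rewrite ltrDl.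
have s0 : 0 < nrm w + 1 by apply: le_lt_trans ws; exact: nrm_ge0.
have [M cM] := entireE s0 ce.
by rewrite {1}(psquot_decomp ws cM) cw; apply/funext => -[|n] /=; rewrite add0r.
Qed.

(** A positive count provides a zero, and dividing it out lowers the count by
    exactly one. The threshold x is lowered by one at the same time; it stays
    positive for N steps, which is why N is the least integer above it. *)
Lemma zero_count_geP N (r x : R) c : entire c -> N%:R - 1 < x <= N%:R ->
  (x%:E <= zero_count (pseval c : R[i] -> R[i]^o) r)%E <-> has_zeros N r c.
Proof.
elim: N x c => [|N IH] x c ce /andP[x1 x2] /=.
  split=> // _; apply: (@le_trans _ _ 0%E); first by rewrite lee_fin.
  by apply: esum_ge0 => z _; exact: zero_mult_ge0.
have xN : N%:R - 1 < x - 1 <= N%:R by move: x1 x2; rewrite -natr1; lra.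
split=> [h|[w [wr cw h]]]; last first.
  rewrite (mulXsub_psquot ce cw) zero_count_mulXsub//; last exact: entire_psquot.
  move/(IH _ _ (entire_psquot w ce) xN) : h.
  by rewrite EFinB leeBlDl.
have [[w wr cw]|nw] := pselect (exists2 w, nrm w < r & pseval c w = 0).
  exists w; split => //; apply/(IH _ _ (entire_psquot w ce) xN).
  by move: h; rewrite {1}(mulXsub_psquot ce cw) zero_count_mulXsub ?EFinB ?leeBlDl//; exact: entire_psquot.
exfalso; move: h; rewrite /zero_count esum1.
  by rewrite lee_fin leNgt => /negP; apply; apply: le_lt_trans x1; rewrite -natr1 addrK.
move=> z /=; rewrite nrm_ltc => zr; apply/eqP; rewrite eq_le zero_mult_ge0 andbT.
rewrite zero_multE//; apply: ge_ereal_sup => _ [[|k] /= h <-]//.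
by exfalso; apply: nw; exists z => //; exact: (h 0%N).
Qed.

End PowerSeries.

(** * Approximate zeros and compactness *)
Section ApproxZeros.
Variable R : realType.
Implicit Types (z w v : R[i]) (c u : nat -> R[i]) (s M e r rho : R).

(** Same recursion as for exact zeros. The candidate points are restricted to a
    set [S], to be taken countable for measurability and a ball for limits. *)
Fixpoint near_zeros (S : set R[i]) (N : nat) e c : Prop :=
  if N is N'.+1 then
    exists w, [/\ S w, nrm (pseval c w) < e & near_zeros S N' e (psquot w c)]
  else True.

(** The approximating points are kept; only their values move. *)
Lemma near_zeros_perturb (S : set R[i]) rho s N e e' : 0 <= rho < s ->
  (forall w, S w -> nrm w <= rho) -> e < e' ->
  exists2 dl : R, 0 < dl & forall c d M, coef_bounded s M c -> coef_bounded s dl d ->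
    near_zeros S N e c -> near_zeros S N e' (c \+ d).
Proof.
move=> /andP[rho0 rs] Srho ee'; elim: N => [|N [dl0 dl00 IH]]; first by exists 1.
have s0 : 0 < s := le_lt_trans rho0 rs.
have sr : 0 < s - rho by rewrite subr_gt0.
exists (Num.min (dl0 * (s - rho)) ((e' - e) * (s - rho) / s)).
  by rewrite lt_min !mulr_gt0 ?subr_gt0// invr_gt0.
set dl := Num.min _ _; move=> c d M cM dd [w [Sw cw h]].
have ws : nrm w < s by apply: le_lt_trans rs; exact: Srho.
have sw : s - rho <= s - nrm w by rewrite lerD2l lerN2 Srho.
have dl_ge0 : 0 <= dl := coef_bounded_ge0 dd.
have le1 : dl <= dl0 * (s - rho) by rewrite /dl ge_min lexx.
have le2 : dl <= (e' - e) * (s - rho) / s by rewrite /dl ge_min lexx orbT.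
exists w; split => //.
  rewrite (psevalD ws cM dd); apply: le_lt_trans (ler_nrmD _ _) _.
  rewrite -[ltRHS](subrK e) [ltRHS]addrC ltr_leD// (le_trans (nrm_pseval ws dd))//.
  rewrite ler_pdivrMr; last exact: lt_le_trans sw.
  move: le2; rewrite ler_pdivlMr// => /le_trans; apply.
  by rewrite ler_wpM2l// subr_ge0 ltW.
rewrite (psquotD ws cM dd); apply: IH h; first exact: coef_bounded_psquot cM.
move=> n; apply: le_trans (coef_bounded_psquot ws dd n) _.
rewrite ler_pdivrMr; last exact: lt_le_trans sw.
by apply: (le_trans le1); rewrite ler_wpM2l// ltW.
Qed.

Lemma has_zeros_sub r r' N c : r <= r' -> has_zeros N r c -> has_zeros N r' c.
Proof.
move=> rr'; elim: N c => //= N IH c [w [Sw cw h]].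
by exists w; split; [exact: lt_le_trans rr'|exact: cw|exact: IH].
Qed.

(** A common Lipschitz constant, on the disk of radius rho, for w |-> f(w) and
    w |-> [psquot w c], when |c_n| s^n <= M. *)
Definition lip_const rho s M := M / (s - rho) / (s - rho) * (s + 1) + 1.

Lemma lip_const_gt0 rho s M : 0 <= rho < s -> 0 <= M -> 0 < lip_const rho s M.
Proof.
move=> /andP[rho0 rs] M0; have sr : 0 <= s - rho by rewrite subr_ge0 ltW.
rewrite ltr_wpDl// mulr_ge0// ?divr_ge0// addr_ge0//.
exact: le_trans (ltW rs).
Qed.

Lemma lip_factor rho s M c w w' : 0 <= rho < s -> coef_bounded s M c ->
  nrm w <= rho -> nrm w' <= rho ->
  0 <= M / (s - nrm w) / (s - nrm w') <= M / (s - rho) / (s - rho).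
Proof.
move=> /andP[rho0 rs] cM wr wr'; have M0 := coef_bounded_ge0 cM.
have sr : 0 < s - rho by rewrite subr_gt0.
have sw : s - rho <= s - nrm w by rewrite lerD2l lerN2.
have sw' : s - rho <= s - nrm w' by rewrite lerD2l lerN2.
rewrite !divr_ge0 ?(le_trans (ltW sr) sw) ?(le_trans (ltW sr) sw')//=.
have V x : s - rho <= x -> x^-1 <= (s - rho)^-1.
  by move=> h; rewrite lef_pV2 ?posrE// (lt_le_trans sr).
have p1 := le_trans (ltW sr) sw; have p2 := le_trans (ltW sr) sw'.
apply: ler_pM; rewrite ?divr_ge0 ?invr_ge0//; last exact: V.
by rewrite ler_wpM2l//; exact: V.
Qed.

Lemma pseval_lipschitz rho s M c w w' : 0 <= rho < s -> coef_bounded s M c ->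
  nrm w <= rho -> nrm w' <= rho ->
  nrm (pseval c w' - pseval c w) <= nrm (w' - w) * lip_const rho s M.
Proof.
move=> rhos cM wr wr'; have /andP[rho0 rs] := rhos.
have ws : nrm w < s := le_lt_trans wr rs.
have ws' : nrm w' < s := le_lt_trans wr' rs.
have s0 : 0 <= s := le_trans rho0 (ltW rs).
rewrite (pseval_sub ws ws' cM) addrAC subrr add0r nrmM ler_wpM2l ?nrm_ge0//.
apply: le_trans (nrm_pseval ws' (coef_bounded_psquot ws cM)) _.
have /andP[h0 h] := lip_factor rhos cM wr wr'; rewrite mulrAC.
apply: (le_trans (ler_wpM2r s0 h)); rewrite /lip_const mulrDr mulr1.
by have := le_trans h0 h; lra.
Qed.

Lemma psquot_lipschitz rho s M c w w' : 0 <= rho < s -> coef_bounded s M c ->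
  nrm w <= rho -> nrm w' <= rho ->
  coef_bounded s (nrm (w' - w) * lip_const rho s M) (fun n => psquot w' c n - psquot w c n).
Proof.
move=> rhos cM wr wr'; have /andP[rho0 rs] := rhos.
have ws : nrm w < s := le_lt_trans wr rs.
have ws' : nrm w' < s := le_lt_trans wr' rs.
move=> n; apply: le_trans (coef_bounded_psquotB ws ws' cM n) _.
rewrite ler_wpM2l ?nrm_ge0//.
have /andP[h0 h] := lip_factor rhos cM wr wr'; apply: (le_trans h).
have : 0 <= M / (s - rho) / (s - rho) * s.
  by rewrite mulr_ge0// ?(le_trans rho0 (ltW rs))// (le_trans h0).
rewrite /lip_const mulrDr mulr1; lra.
Qed.

Lemma near_zeros_mono (S : set R[i]) N e e' c : e <= e' ->
  near_zeros S N e c -> near_zeros S N e' c.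
Proof.
move=> ee'; elim: N c => //= N IH c [w [Sw cw h]].
by exists w; split; [exact: Sw|exact: lt_le_trans ee'|exact: IH].
Qed.

(** Moving the point by which one divides is a small perturbation of the
    quotient. *)
Lemma near_zeros_psquot (S : set R[i]) rho s N M e e' : 0 <= rho < s -> 0 <= M ->
  (forall w, S w -> nrm w <= rho) -> e < e' ->
  exists2 dl : R, 0 < dl & forall c w w', coef_bounded s M c -> nrm w <= rho ->
    nrm w' <= rho -> nrm (w' - w) < dl ->
    near_zeros S N e (psquot w c) -> near_zeros S N e' (psquot w' c).
Proof.
move=> rhos M0 Srho ee'; have /andP[rho0 rs] := rhos.
have K0 := lip_const_gt0 rhos M0.
have [dl dl0 pert] := near_zeros_perturb N rhos Srho ee'.
exists (dl / lip_const rho s M); first by rewrite divr_gt0.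
move=> c w w' cM wr wr' ww' h.
have -> : psquot w' c = psquot w c \+ (fun n => psquot w' c n - psquot w c n).
  by apply/funext => n /=; rewrite addrC subrK.
apply: (pert _ _ _ (coef_bounded_psquot (le_lt_trans wr rs) cM) _ h) => n.
apply: le_trans (psquot_lipschitz rhos cM wr wr' n) _.
by rewrite -ler_pdivlMr// ltW.
Qed.

(** Exact zeros are replaced one at a time by nearby points of the dense set,
    half of the tolerance being kept for the perturbed quotient. *)
Lemma has_zeros_near (S : set R[i]) rho s N e c M : 0 <= rho < s ->
  (forall w, S w -> nrm w <= rho) ->
  (forall w (dl : R), nrm w < rho -> 0 < dl -> exists2 w', S w' & nrm (w' - w) < dl) ->
  coef_bounded s M c -> 0 < e -> has_zeros N rho c -> near_zeros S N e c.
Proof.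
move=> rhos Srho Sd; have /andP[rho0 rs] := rhos.
elim: N c M e => //= N IH c M e cM e0 [w [wr cw h]].
have M0 := coef_bounded_ge0 cM.
have ws : nrm w < s := lt_trans wr rs.
have e20 : 0 < e / 2 by rewrite divr_gt0.
have h2 := IH _ _ _ (coef_bounded_psquot ws cM) e20 h.
have [|dl dl0 pert] := @near_zeros_psquot S rho s N M (e / 2) e rhos M0 Srho; first by lra.
have K0 := lip_const_gt0 rhos M0.
have [|w' Sw'] := Sd w (Num.min dl (e / lip_const rho s M)) wr.
  by rewrite lt_min dl0 divr_gt0.
rewrite lt_min => /andP[ww1 ww2]; have wr' := Srho _ Sw'.
exists w'; split; first exact: Sw'.
  rewrite -[pseval c w']subr0 -cw; apply: le_lt_trans (pseval_lipschitz rhos cM (ltW wr) wr') _.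
  by rewrite -ltr_pdivlMr.
exact: pert cM (ltW wr) wr' ww1 h2.
Qed.

Lemma cluster_seq rho (w : nat -> R[i]) : (forall i, nrm (w i) <= rho) ->
  exists2 l, nrm l <= rho &
    forall dl : R, 0 < dl -> forall I, exists2 i, (I <= i)%N & nrm (w i - l) < dl.
Proof.
move=> wr.
have cK : compact (`[- rho, rho] `*` `[- rho, rho])%classic.
  by apply: compact_setX; exact: segment_compact.
pose g i := (complex.Re (w i), complex.Im (w i)).
have gK : (g @ \oo) (`[- rho, rho] `*` `[- rho, rho])%classic.
  exists 0%N => // i _; split; rewrite /= in_itv /= -ler_norml (le_trans _ (wr i))//.
    exact: Re_le_nrm.
  exact: Im_le_nrm.
have [[a b] [_ cab]] := cK (g @ \oo) _ gK.
have cl (dl : R) : 0 < dl -> forall I, exists2 i, (I <= i)%N & nrm (w i - (a +i* b)) < dl.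
  move=> dl0 I.
  have gI : (g @ \oo) (g @` [set i | (I <= i)%N]).
    by exists I => // i /= Ii; exists i.
  have nb : nbhs (a, b) (ball a (dl / 2) `*` ball b (dl / 2)).
    by exists (ball a (dl / 2), ball b (dl / 2)) => //; split; apply: nbhsx_ballx; rewrite divr_gt0.
  have [p [[i Ii <-] [/= h1 h2]]] := cab _ _ gI nb.
  exists i => //; apply: le_lt_trans (nrm_le_ReIm _) _.
  move: h1 h2; rewrite /ball /= /g; case: (w i) => x y /= h1 h2.
  by rewrite [ltRHS]splitr ltrD// distrC.
exists (a +i* b) => //.
apply/ler_addgt0Pr => dl dl0; have [i _ wi] := cl _ dl0 0%N.
rewrite -[a +i* b](subKr (w i)); apply: le_trans (ler_nrmB _ _) _.
by rewrite lerD// ltW.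
Qed.

(** Take 1/(i+1)-approximate first zeros w_i and a cluster point l of them: l is a
    zero by continuity, and dividing at l instead of w_i preserves the remaining
    approximate zeros. The point l may lie on the circle of radius rho, hence in
    the open disk of radius r only for r > rho. *)
Lemma near_zeros_closed (S : set R[i]) rho s r N c M : 0 <= rho < s -> rho < r ->
  (forall w, S w -> nrm w <= rho) -> coef_bounded s M c ->
  (forall e, 0 < e -> near_zeros S N e c) -> has_zeros N r c.
Proof.
move=> rhos rr Srho; have /andP[rho0 rs] := rhos.
have s0 : 0 < s := le_lt_trans rho0 rs.
have sr : 0 < s - rho by rewrite subr_gt0.
elim: N c M => //= N IH c M cM h.
have M0 := coef_bounded_ge0 cM.
have p0 i : 0 < i.+1%:R^-1 :> R by rewrite invr_gt0.
have [w hw] := choice (fun i : nat => h _ (p0 i)).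
have wr i : nrm (w i) <= rho by apply: Srho; case: (hw i).
have [l lr cl] := cluster_seq wr.
have ls : nrm l < s := le_lt_trans lr rs.
have dM := coef_bounded_psquot ls cM.
have small e : 0 < e -> exists i : nat, i.+1%:R^-1 < e.
  move=> e0; exists (Num.truncn e^-1); rewrite invf_plt ?posrE//.
  exact: truncnS_gt.
have step (dl e : R) : 0 < dl -> 0 < e ->
    exists i : nat, nrm (w i - l) < dl /\ i.+1%:R^-1 < e.
  move=> dl0 e0; have [I Ie] := small _ e0; have [i Ii wi] := cl _ dl0 I.
  exists i; split => //; apply: le_lt_trans Ie.
  by rewrite lef_pV2 ?posrE// ler_nat ltnS.
have K0 := lip_const_gt0 rhos M0.
exists l; split; first exact: le_lt_trans rr.
  apply/eqP; rewrite -nrm_eq0 eq_le nrm_ge0 andbT.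
  apply/ler_addgt0Pr => e e0; rewrite add0r.
  have [||i [wi ie]] := step (e / 2 / lip_const rho s M) (e / 2); rewrite ?divr_gt0//.
  have [_ wi2 _] := hw i.
  rewrite -[pseval c l](subKr (pseval c (w i))); apply: le_trans (ler_nrmB _ _) _.
  rewrite [leRHS]splitr lerD//; first exact/ltW/(lt_trans wi2).
  apply: le_trans (pseval_lipschitz rhos cM lr (wr i)) _.
  by rewrite -ler_pdivlMr// ltW.
apply: (IH _ _ dM) => e e0.
have [|dl dl0 pert] := @near_zeros_psquot S rho s N M (e / 2) e rhos M0 Srho; first by lra.
have [||i [wi ie]] := step dl (e / 2); rewrite ?divr_gt0//.
have [_ _ h2] := hw i.
apply: (pert _ (w i) l cM (wr i) lr); first by rewrite nrmB.
exact: near_zeros_mono (ltW ie) h2.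
Qed.

(** Each zero divided out costs a factor 1 / (s - r) in the bound M, and each
    linear factor multiplied back costs a factor 2. With truncated subtraction,
    r^(N - n) s^-(n - N) is the largest r^i s^-j that multiplying N factors
    X - w_i can bring to the coefficient of index n. *)
Lemma has_zeros_coef_le s M r N c n : 0 <= r < s -> entire c -> coef_bounded s M c ->
  has_zeros N r c ->
  nrm (c n) * s ^+ (n - N) * (s - r) ^+ N <= M * 2 ^+ N * r ^+ (N - n).
Proof.
move=> /andP[r0 rs]; have sr : 0 < s - r by rewrite subr_gt0.
have s0 : 0 <= s := le_trans r0 (ltW rs).
elim: N c M n => [|N IH] c M n ce cM /=.
  by move=> _; rewrite subn0 sub0n !expr0 !mulr1; exact: cM.
move=> [w [wr cw h]]; have ws : nrm w < s := lt_trans wr rs.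
have uM : coef_bounded s (M / (s - r)) (psquot w c).
  move=> k; apply: (le_trans (coef_bounded_psquot ws cM k)).
  rewrite ler_wpM2l ?(coef_bounded_ge0 cM)// lef_pV2 ?posrE ?subr_gt0//.
  by rewrite lerD2l lerN2 ltW.
have {}IH k : nrm (psquot w c k) * s ^+ (k - N) * (s - r) ^+ N.+1 <=
    M * 2 ^+ N * r ^+ (N - k).
  have := IH _ _ k (entire_psquot w ce) uM h.
  move=> hh; rewrite exprSr mulrA; apply: le_trans (ler_wpM2r (ltW sr) hh) _.
  rewrite le_eqVlt; apply/orP; left; apply/eqP; field.
  by rewrite gt_eqF.
have M0 := coef_bounded_ge0 cM.
rewrite (mulXsub_psquot ce cw) /mulXsub; set u := psquot w c in uM IH *.
have srN : 0 <= (s - r) ^+ N.+1 by rewrite exprn_ge0// ltW.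
case: n => [|n].
  rewrite sub0r nrmN nrmM sub0n expr0 mulr1 subn0.
  have := IH 0%N; rewrite sub0n expr0 mulr1 subn0 => h0.
  apply: (@le_trans _ _ (r * (nrm (u 0%N) * (s - r) ^+ N.+1))).
    by rewrite mulrA ler_wpM2r// ler_wpM2r ?nrm_ge0// ltW.
  apply: (le_trans (ler_wpM2l r0 h0)); rewrite [2 ^+ N.+1]exprS [r ^+ N.+1]exprS.
  have : 0 <= M * 2 ^+ N * (r * r ^+ N) by rewrite !mulr_ge0 ?exprn_ge0.
  lra.
rewrite !subSS.
have hA := IH n; have hB := IH n.+1.
apply: (@le_trans _ _ ((nrm (u n) + r * nrm (u n.+1)) * s ^+ (n - N) * (s - r) ^+ N.+1)).
  rewrite ler_wpM2r// ler_wpM2r ?exprn_ge0//.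
  apply: (le_trans (ler_nrmB _ _)); rewrite lerD2l nrmM ler_wpM2r ?nrm_ge0//.
  exact: ltW.
have hC : r * nrm (u n.+1) * s ^+ (n - N) * (s - r) ^+ N.+1 <=
    M * 2 ^+ N * r ^+ (N - n).
  have [nN|Nn] := ltnP n N.
    have e1 : (n - N = n.+1 - N)%N by clear -nN; lia.
    have e2 : (N - n = (N - n.+1).+1)%N by clear -nN; lia.
    rewrite e1 e2; apply: le_trans (_ : r * (M * 2 ^+ N * r ^+ (N - n.+1)) <= _).
      by apply: le_trans (ler_wpM2l r0 hB); rewrite !mulrA.
    by rewrite [r ^+ (N - n.+1).+1]exprS mulrCA mulrA.
  have e1 : (n.+1 - N = (n - N).+1)%N by clear -Nn; lia.
  have e2 : (N - n = N - n.+1)%N by clear -Nn; lia.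
  rewrite e2; apply: le_trans hB; rewrite e1 [s ^+ (n - N).+1]exprS.
  rewrite ler_wpM2r// mulrA ler_wpM2r ?exprn_ge0// mulrC ler_wpM2l ?nrm_ge0//.
  exact: ltW.
rewrite !mulrDl [2 ^+ N.+1]exprS; lra.
Qed.

End ApproxZeros.

(** * Zeros from a dominant coefficient *)
Section Pellet.
Variable R : realType.
Variable rho : R.
Hypothesis rho_gt0 : 0 < rho.
Implicit Types (p f g : {poly R[i]}) (w z : R[i]) (N : nat).

(** The weighted l1 norm, which is submultiplicative, and its restriction to the
    coefficients of index at least N. *)
Definition l1 p : R := \sum_(i < size p) nrm p`_i * rho ^+ i.
Definition l1hi N p : R := \sum_(i < size p | (N <= i)%N) nrm p`_i * rho ^+ i.

Lemma rho_ge0 : 0 <= rho. Proof. exact: ltW. Qed.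

Lemma l1E K p : (size p <= K)%N -> l1 p = \sum_(i < K) nrm p`_i * rho ^+ i.
Proof.
move=> pK; rewrite /l1 (big_ord_widen K (fun i => nrm p`_i * rho ^+ i) pK).
rewrite [RHS](bigID (fun i : 'I_K => (i < size p)%N)) /= [X in _ + X]big1 ?addr0//.
by move=> i; rewrite -leqNgt => pi; rewrite nth_default// nrm0 mul0r.
Qed.

Lemma l1hiE N K p : (size p <= K)%N ->
  l1hi N p = \sum_(i < K | (N <= i)%N) nrm p`_i * rho ^+ i.
Proof.
move=> pK; rewrite /l1hi big_mkcond /= [RHS]big_mkcond /=.
rewrite (big_ord_widen K (fun i => if (N <= i)%N then nrm p`_i * rho ^+ i else 0) pK).
rewrite [RHS](bigID (fun i : 'I_K => (i < size p)%N)) /= [X in _ + X]big1 ?addr0//.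
by move=> i; rewrite -leqNgt => pi; rewrite nth_default// nrm0 mul0r if_same.
Qed.

Lemma term_ge0 p i : 0 <= nrm p`_i * rho ^+ i.
Proof. by rewrite mulr_ge0 ?nrm_ge0// exprn_ge0// rho_ge0. Qed.

Lemma l1_ge0 p : 0 <= l1 p.
Proof. by apply: sumr_ge0 => i _; exact: term_ge0. Qed.

Lemma l1hi_le N p : l1hi N p <= l1 p.
Proof.
rewrite /l1hi big_mkcond /=; apply: ler_sum => i _; case: ifP => // _.
exact: term_ge0.
Qed.

Lemma l1D p f : l1 (p + f) <= l1 p + l1 f.
Proof.
pose K := maxn (size p) (size f).
rewrite (@l1E K) ?size_polyD// (@l1E K p) ?leq_maxl// (@l1E K f) ?leq_maxr//.
rewrite -big_split /=; apply: ler_sum => i _; rewrite coefD -mulrDl.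
by rewrite ler_wpM2r ?ler_nrmD// exprn_ge0// rho_ge0.
Qed.

Lemma l1hiD N p f : l1hi N (p + f) <= l1hi N p + l1hi N f.
Proof.
pose K := maxn (size p) (size f).
rewrite (@l1hiE N K) ?size_polyD// (@l1hiE N K p) ?leq_maxl// (@l1hiE N K f) ?leq_maxr//.
rewrite -big_split /=; apply: ler_sum => i _; rewrite coefD -mulrDl.
by rewrite ler_wpM2r ?ler_nrmD// exprn_ge0// rho_ge0.
Qed.

Lemma l1Z a p : l1 (a *: p) = nrm a * l1 p.
Proof.
rewrite (@l1E (size p)) ?size_scale_leq// /l1 mulr_sumr.
by apply: eq_bigr => i _; rewrite coefZ nrmM mulrA.
Qed.

Lemma l1hiZ N a p : l1hi N (a *: p) = nrm a * l1hi N p.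
Proof.
rewrite (@l1hiE N (size p)) ?size_scale_leq// /l1hi mulr_sumr.
by apply: eq_bigr => i _; rewrite coefZ nrmM mulrA.
Qed.

Lemma l1_0 : l1 0 = 0.
Proof. by rewrite /l1 size_poly0 big_ord0. Qed.

Lemma l1N p : l1 (- p) = l1 p.
Proof. by rewrite -scaleN1r l1Z nrmN nrm1 mul1r. Qed.
Lemma l1hiN N p : l1hi N (- p) = l1hi N p.
Proof. by rewrite -scaleN1r l1hiZ nrmN nrm1 mul1r. Qed.

Lemma l1_sum (I : Type) (s : seq I) (F : I -> {poly R[i]}) :
  l1 (\sum_(i <- s) F i) <= \sum_(i <- s) l1 (F i).
Proof.
elim/big_ind2 : _ => [|x1 x2 y1 y2 h1 h2|//]; first by rewrite l1_0.
by rewrite (le_trans (l1D _ _))// lerD.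
Qed.

Lemma l1XnM n p : l1 ('X^n * p) = rho ^+ n * l1 p.
Proof.
rewrite (@l1E (n + size p)); last first.
  by rewrite mulrC (leq_trans (size_polyMleq _ _))// size_polyXn addnS /= addnC.
rewrite big_split_ord /= big1 ?add0r; last first.
  by move=> i _; rewrite coefXnM ltn_ord nrm0 mul0r.
rewrite /l1 mulr_sumr; apply: eq_bigr => i _.
by rewrite coefXnM ltnNge leq_addr /= addKn exprD mulrCA.
Qed.

Lemma l1hiXnM N p : l1hi N ('X^N * p) = rho ^+ N * l1 p.
Proof.
rewrite -l1XnM (@l1hiE N (N + size p)); last first.
  by rewrite mulrC (leq_trans (size_polyMleq _ _))// size_polyXn addnS /= addnC.
rewrite (@l1E (N + size p)); last first.
  by rewrite mulrC (leq_trans (size_polyMleq _ _))// size_polyXn addnS /= addnC.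
rewrite big_mkcond; apply: eq_bigr => i _; case: leqP => // iN.
by rewrite coefXnM iN nrm0 mul0r.
Qed.

Lemma l1M p f : l1 (p * f) <= l1 p * l1 f.
Proof.
rewrite -{1}[p]coefK poly_def mulr_suml (le_trans (l1_sum _ _))//.
rewrite [l1 p]/l1 mulr_suml; apply: ler_sum => i _.
by rewrite -scalerAl l1Z l1XnM mulrA.
Qed.

(** A quantitative form of: no multiple of f, other than 0, has degree less
    than N, the multiples being taken in the completion of the polynomials for
    the weighted l1 norm, where the factors X - v with |v| > rho are units. *)
Definition cobounded N f :=
  exists2 k : R, 0 < k & forall g, k * l1 g <= l1hi N (f * g).

(** Multiplying by the monomial of index N scales the norm exactly, and the other
    coefficients form a perturbation of smaller norm. *)
Lemma dominant_cobounded N f :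
  l1 (f - f`_N *: 'X^N) < nrm f`_N * rho ^+ N -> cobounded N f.
Proof.
set e := f - _ => he.
exists (nrm f`_N * rho ^+ N - l1 e); first by rewrite subr_gt0.
move=> g; rewrite mulrBl lerBlDr.
have -> : nrm f`_N * rho ^+ N * l1 g = l1hi N (f * g - e * g).
  have -> : f * g - e * g = f`_N *: ('X^N * g).
    by rewrite -mulrBl /e opprB addrC subrK scalerAl.
  by rewrite l1hiZ l1hiXnM mulrA.
rewrite (le_trans (l1hiD _ _ _))// lerD2l l1hiN.
by rewrite (le_trans (l1hi_le _ _))// l1M.
Qed.

(** For |v| > rho the factor X - v is invertible in the completed algebra, with
    inverse the limit of - v^-J times B, where (X - v) B = X^J - v^J. The bound
    for f (X - v) is applied to g B, and J tends to infinity. *)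
Lemma cobounded_div N f v : rho < nrm v -> cobounded N (f * ('X - v%:P)) ->
  cobounded N f.
Proof.
move=> rv [k k0 hk]; have v0 : 0 < nrm v := lt_trans rho_gt0 rv.
have rv0 : 0 < rho + nrm v by rewrite addr_gt0.
pose t := rho / nrm v.
have t0 : 0 <= t by rewrite divr_ge0// ltW.
have t1 : t < 1 by rewrite ltr_pdivrMr// mul1r.
exists (k / (rho + nrm v)); first by rewrite divr_gt0.
move=> g.
have key J : k / (rho + nrm v) * (1 - t ^+ J) * l1 g <= t ^+ J * l1 (f * g) + l1hi N (f * g).
  pose B : {poly R[i]} := \sum_(i < J) 'X^(J.-1 - i) * (v%:P) ^+ i.
  have BE : ('X - v%:P) * B = 'X^J - (v ^+ J)%:P by rewrite /B -subrXX polyC_exp.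
  have h1 := hk (g * B).
  have e1 : f * ('X - v%:P) * (g * B) = 'X^J * (f * g) - v ^+ J *: (f * g).
    have -> : f * ('X - v%:P) * (g * B) = ('X - v%:P) * B * (f * g) by ring.
    by rewrite BE mulrBl mul_polyC.
  have h2 : l1hi N ('X^J * (f * g) - v ^+ J *: (f * g)) <=
      rho ^+ J * l1 (f * g) + nrm v ^+ J * l1hi N (f * g).
    rewrite (le_trans (l1hiD _ _ _))// l1hiN l1hiZ nrmX lerD2r.
    by rewrite (le_trans (l1hi_le _ _))// l1XnM.
  rewrite e1 in h1.
  have h3 : (nrm v ^+ J - rho ^+ J) * l1 g <= (rho + nrm v) * l1 (g * B).
    have : l1 (v ^+ J *: g) <= l1 ('X^J * g) + l1 (('X - v%:P) * (g * B)).
      have -> : v ^+ J *: g = 'X^J * g + - (('X - v%:P) * (g * B)).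
        have -> : ('X - v%:P) * (g * B) = ('X - v%:P) * B * g by ring.
        by rewrite BE mulrBl mul_polyC opprB addrC subrK.
      by rewrite (le_trans (l1D _ _))// l1N.
    rewrite l1Z l1XnM nrmX => h3; rewrite mulrBl lerBlDl; apply: (le_trans h3).
    rewrite lerD2l (le_trans (l1M _ _))// ler_wpM2r ?l1_ge0//.
    rewrite (le_trans (l1D _ _))// l1N -['X]mulr1 -['X]expr1 l1XnM expr1.
    have l11 a : l1 a%:P <= nrm a.
      rewrite (@l1E 1) ?size_polyC_leq1// big_ord1 coefC eqxx expr0 mulr1//.
    by rewrite lerD// -[leRHS]mulr1 ler_wpM2l ?rho_ge0// (le_trans (l11 1))// nrm1.
  have vJ : 0 < nrm v ^+ J by rewrite exprn_gt0.
  have vt : nrm v ^+ J * t ^+ J = rho ^+ J.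
    by rewrite -exprMn /t mulrC divfK// gt_eqF.
  rewrite -(ler_pM2l vJ) [leRHS]mulrDr [X in _ <= X + _]mulrA vt.
  apply: le_trans (le_trans h1 h2).
  have -> : nrm v ^+ J * (k / (rho + nrm v) * (1 - t ^+ J) * l1 g) =
     k / (rho + nrm v) * ((nrm v ^+ J - nrm v ^+ J * t ^+ J) * l1 g) by ring.
  rewrite vt.
  rewrite -mulrA ler_wpM2l ?(ltW k0)//.
  by rewrite mulrC ler_pdivrMr// [leRHS]mulrC.
have cl : k / (rho + nrm v) * (1 - t ^+ J) * l1 g @[J --> \oo] -->
    k / (rho + nrm v) * (1 - 0) * l1 g.
  apply: cvgMl; apply: cvgMr; apply: cvgB; first exact: cvg_cst.
  by apply: cvg_expr; rewrite ger0_norm.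
have cr : t ^+ J * l1 (f * g) + l1hi N (f * g) @[J --> \oo] -->
    0 * l1 (f * g) + l1hi N (f * g).
  apply: cvgD; last exact: cvg_cst.
  by apply: cvgMl; apply: cvg_expr; rewrite ger0_norm.
have := ler_cvg_to cl cr; rewrite subr0 mulr1 mul0r add0r; apply.
by near=> J; exact: key.
Unshelve. all: by end_near. Qed.

(** Once all the roots outside the circle are removed, the bound tested on the
    constant 1 exhibits a coefficient of index at least N. *)
Lemma cobounded_roots N a (rs : seq R[i]) :
  cobounded N (a *: \prod_(z <- rs) ('X - z%:P)) ->
  (N <= count (fun z => (nrm z <= rho)%R) rs)%N.
Proof.
pose inn := [seq z <- rs | (nrm z <= rho)%R].
pose out := [seq z <- rs | ~~ (nrm z <= rho)%R].
have -> : \prod_(z <- rs) ('X - z%:P) =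
    \prod_(z <- inn) ('X - z%:P) * \prod_(z <- out) ('X - z%:P).
  by rewrite (bigID (fun z => nrm z <= rho)) /= /inn /out !big_filter.
rewrite scalerAl; set q := a *: _ => h.
have hout : all (fun z => rho < nrm z) out.
  by apply/allP => z; rewrite mem_filter -ltNge => /andP[].
have {h hout} : cobounded N q.
  elim: out hout h => [|z out IH] /=; first by rewrite big_nil mulr1.
  move=> /andP[zr ho]; rewrite big_cons mulrCA mulrC => h.
  by apply: IH => //; exact: cobounded_div zr h.
case=> k k0 /(_ 1); rewrite mulr1 => h.
have l11 : 0 < l1 1.
  by rewrite (@l1E 1) ?size_poly1// big_ord1 coefC eqxx expr0 mulr1 nrm1.
have : 0 < l1hi N q by apply: lt_le_trans h; rewrite mulr_gt0.
rewrite leqNgt; apply: contraTN => cN; rewrite -leNgt /l1hi big1// => i Ni.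
exfalso; have : (size q <= (count (fun z => (nrm z <= rho)%R) rs).+1)%N.
  by rewrite (leq_trans (size_scale_leq _ _))// size_prod_XsubC size_filter.
move/(leq_trans (ltn_ord i)); rewrite ltnS => /(leq_trans Ni).
by rewrite leqNgt cN.
Qed.

End Pellet.

Section DominantCoefficient.
Variable R : realType.
Implicit Types (c : nat -> R[i]) (r rho s M e : R).

Lemma entire_poly (p : {poly R[i]}) : entire (fun n => p`_n).
Proof.
move=> s s0; exists (\sum_(i < size p) nrm p`_i * s ^+ i) => n.
have t0 (i : nat) : 0 <= nrm p`_i * s ^+ i.
  by rewrite mulr_ge0 ?nrm_ge0// exprn_ge0// ltW.
have [np|pn] := ltnP n (size p).
  by rewrite (bigD1 (Ordinal np))//= lerDl sumr_ge0.
by rewrite nth_default// nrm0 mul0r sumr_ge0.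
Qed.

Lemma poly_has_zeros N r (rs : seq R[i]) (q : {poly R[i]}) :
  all (fun z => (nrm z < r)%R) rs -> (N <= size rs)%N ->
  has_zeros N r (fun n => (\prod_(z <- rs) ('X - z%:P) * q)`_n).
Proof.
elim: N rs => // N IH [|z rs] //= /andP[zr rsr] Ns.
set f := \prod_(z <- rs) ('X - z%:P) * q.
have -> : (fun n => (\prod_(j <- z :: rs) ('X - j%:P) * q)`_n) =
    mulXsub z (fun n => f`_n).
  apply/funext => n; rewrite big_cons -mulrA -/f mulrBl coefB coefXM coefCM.
  by case: n.
have zs : nrm z < nrm z + 1 by rewrite ltrDl.
have s0 : 0 < nrm z + 1 by apply: le_lt_trans zs; exact: nrm_ge0.
have [M fM] := entireE s0 (entire_poly f).
exists z; split => //; first by rewrite (pseval_mulXsub z zs fM) subrr mul0r.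
by rewrite (psquot_mulXsub zs fM); exact: IH.
Qed.

Lemma has_zeros_near_ball (S : set R[i]) r N e c : 0 < e ->
  (forall w, nrm w < r -> S w) -> has_zeros N r c -> near_zeros S N e c.
Proof.
move=> e0 Sr; elim: N c => //= N IH c [w [wr cw h]].
by exists w; split; [exact: Sr|rewrite cw nrm0|exact: IH].
Qed.

Lemma dominant_poly_has_zeros N (rho r : R) (p : {poly R[i]}) : 0 < rho < r ->
  \sum_(i < size p | i != N :> nat) nrm p`_i * rho ^+ i < nrm p`_N * rho ^+ N ->
  has_zeros N r (fun n => p`_n).
Proof.
move=> /andP[rho0 rr] dom.
have h : cobounded rho N p.
  apply: dominant_cobounded => //; apply: le_lt_trans dom.
  rewrite (@l1E _ _ (size p)); last first.
    rewrite (leq_trans (size_polyD _ _))// geq_max leqnn size_polyN.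
    have [->|pN] := eqVneq p`_N 0; first by rewrite scale0r size_poly0.
    rewrite (leq_trans (size_scale_leq _ _))// size_polyXn ltnNge.
    by apply: contra pN => /(nth_default 0) ->.
  rewrite [leRHS]big_mkcond /=; apply: ler_sum => i _.
  rewrite coefB coefZ coefXn; case: eqVneq => [->|iN] /=.
    by rewrite mulr1 subrr nrm0 mul0r.
  by rewrite mulr0 subr0.
have [rs pE] := closed_field_poly_normal p.
rewrite pE in h; have cN := cobounded_roots rho0 h.
pose inn := [seq z <- rs | (nrm z <= rho)%R].
pose out := [seq z <- rs | ~~ (nrm z <= rho)%R].
have pE2 : p = \prod_(z <- inn) ('X - z%:P) *
    (lead_coef p *: \prod_(z <- out) ('X - z%:P)).
  rewrite {1}pE -scalerAr; congr (_ *: _).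
  by rewrite (bigID (fun z => nrm z <= rho)) /= /inn /out !big_filter.
have -> : (fun n => p`_n) = (fun n => (\prod_(z <- inn) ('X - z%:P) *
    (lead_coef p *: \prod_(z <- out) ('X - z%:P)))`_n) by rewrite -pE2.
apply: poly_has_zeros; last by rewrite size_filter.
by apply/allP => z; rewrite mem_filter => /andP[zr _]; exact: le_lt_trans rr.
Qed.

(** Pellet's criterion, the special case of Rouche's theorem that compares f with
    its term of index N. The truncations of f are polynomials for which it is
    known, and they are uniformly close to f on a larger disk. *)
Lemma dominant_has_zeros N (rho r B : R) c : entire c -> 0 < rho < r ->
  B < nrm (c N) * rho ^+ N ->
  (forall K, \sum_(i < K | i != N :> nat) nrm (c i) * rho ^+ i <= B) ->
  has_zeros N r c.
Proof.
move=> ce /andP[rho0 rr] BN hB.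
(* Rounding rho up to r' leaves room for the passage to the limit in the
   truncations. *)
pose r' := (rho + r) / 2.
have rho' : rho < r' by rewrite /r'; lra.
have r'r : r' < r by rewrite /r'; lra.
have r's : 0 <= r' < r + 1 by rewrite /r'; apply/andP; split; lra.
pose S := [set w : R[i] | nrm w <= r'].
have SE w : S w -> nrm w <= r' by [].
have [|M0 cM0] := ce (r + 1); first by lra.
have [|M cM] := ce (2 * (r + 1)); first by lra.
have M_ge0 := coef_bounded_ge0 cM.
apply: (near_zeros_closed r's r'r SE cM0) => e e0.
have [|dl dl0 pert] := near_zeros_perturb N r's SE (_ : e / 2 < e); first by lra.
have [K0 hK0] : exists K, M < dl * 2 ^+ K.
  exists (Num.truncn (M / dl)).+1; rewrite mulrC -ltr_pdivrMr//.
  apply: lt_trans (truncnS_gt _) _; rewrite -natrX ltr_nat.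
  exact: ltn_expl.
pose K := maxn K0 N.+1.
pose p : {poly R[i]} := \poly_(i < K) c i.
pose d n := if (n < K)%N then 0 else c n.
have -> : c = (fun n => p`_n) \+ d.
  by apply/funext => n; rewrite /d /= coef_poly; case: ifP; rewrite ?addr0 ?add0r.
have [|M1 pM1] := @entire_poly p (r + 1); first by lra.
apply: (pert _ _ _ pM1).
  move=> n; rewrite /d; case: ltnP => Kn; first by rewrite nrm0 mul0r ltW.
  have := cM n; rewrite exprMn mulrCA => h.
  have n2 : 0 < 2 ^+ n :> R by rewrite exprn_gt0.
  rewrite -(ler_pM2l n2) (le_trans h)// (le_trans (ltW hK0))// mulrC ler_wpM2r ?(ltW dl0)//.
  by rewrite ler_weXn2l ?ler1n// (leq_trans _ Kn)// leq_maxl.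
apply: (@has_zeros_near_ball S r'); [by rewrite divr_gt0|by move=> w /ltW|].
apply: (@dominant_poly_has_zeros N rho); first by rewrite rho0.
have NK : (N < K)%N by rewrite leq_maxr.
have pE i : (i < K)%N -> p`_i = c i by move=> iK; rewrite coef_poly iK.
rewrite pE//; apply: le_lt_trans BN; apply: le_trans (hB K).
rewrite (big_ord_widen_cond K (fun i => i != N) (fun i => nrm p`_i * rho ^+ i)) ?size_poly//.
rewrite [leLHS]big_mkcond [leRHS]big_mkcond; apply: ler_sum => i _ /=.
case: (_ != _) => //=; case: ifP => _; rewrite ?pE//.
by rewrite mulr_ge0 ?nrm_ge0// exprn_ge0// ltW.
Qed.

End DominantCoefficient.

(** * Gaussian mass of disks *)
Section GaussianBounds.
Variable R : realType.
Local Notation mu2 := (@lebesgue_measure R \x @lebesgue_measure R)%E.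
Local Notation plane := (measurableTypeR R * measurableTypeR R)%type.
Local Notation pdf := (@std_complex_normal_pdf R).

Definition disk (t : R) : set plane := [set p | p.1 ^+ 2 + p.2 ^+ 2 <= t ^+ 2].

Lemma measurable_sqnorm :
  measurable_fun [set: plane] (fun p : plane => p.1 ^+ 2 + p.2 ^+ 2 : measurableTypeR R).
Proof.
by apply: measurable_funD; apply: measurable_funX;
  [exact: measurable_fst|exact: measurable_snd].
Qed.

Lemma measurable_disk t : measurable (disk t).
Proof.
have := measurable_sqnorm measurableT (measurable_itv `]-oo, (t ^+ 2)]).
by rewrite setTI; congr measurable; apply/seteqP; split => p /=; rewrite in_itv.
Qed.

Lemma measurable_pdf : measurable_fun [set: plane] pdf.
Proof.
apply: measurable_funM; first exact: measurable_cst.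
apply: measurableT_comp; first exact: measurable_expR.
by apply: measurableT_comp; [exact: oppr_measurable|exact: measurable_sqnorm].
Qed.

Lemma pdf_ge0 p : 0 <= pdf p.
Proof. by rewrite mulr_ge0 ?expR_ge0// invr_ge0 pi_ge0. Qed.

Lemma measurable_Epdf : measurable_fun [set: plane] (fun p : plane => (pdf p)%:E).
Proof. by apply/measurable_EFinP; exact: measurable_pdf. Qed.

Definition square (t : R) : set plane := (`[- t, t] `*` `[- t, t])%classic.

Lemma square_measure (t : R) : 0 <= t ->
  mu2 (square t) = (4 * t ^+ 2)%:E.
Proof.
move=> t0; rewrite /square product_measure1E//=.
rewrite lebesgue_measure_itv /= lte_fin.
case: ltP => h; last first.
  have -> : t = 0 by lra.
  by rewrite mule0 expr0n mulr0.
rewrite -EFinB -EFinM; congr EFin; ring.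
Qed.

Lemma measurable_square (t : R) :
  measurable (square t).
Proof. by apply: measurableX. Qed.

Lemma square_mem (t : R) (p : plane) :
  square t p <-> `|p.1| <= t /\ `|p.2| <= t.
Proof. by rewrite /square /= !in_itv /= !ler_norml. Qed.

Lemma disk_square (t : R) : 0 <= t -> disk t `<=` square t.
Proof.
move=> t0 p pt; apply/square_mem; rewrite -!(ler_sqr (x:=`|_|)) ?nnegrE// !real_normK ?num_real//.
by have := sqr_ge0 p.1; have := sqr_ge0 p.2; rewrite /disk /= in pt; lra.
Qed.

(** The density is at most 1, and the disk lies in a square of area 4 t^2. *)
Lemma gauss_disk_ub (t : R) : 0 <= t ->
  (\int[mu2]_(p in disk t) (pdf p)%:E <= (4 * t ^+ 2)%:E)%E.
Proof.
move=> t0.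
have mf D : measurable_fun (D : set plane) (fun p : plane => (pdf p)%:E).
  exact: measurable_funTS measurable_Epdf.
apply: (@le_trans _ _ (\int[mu2]_(p in square t) (pdf p)%:E)%E).
  apply: ge0_subset_integral => //.
  - exact: measurable_disk.
  - exact: measurable_square.
  - by move=> x _; rewrite lee_fin pdf_ge0.
  - exact: disk_square.
apply: (@le_trans _ _ (\int[mu2]_(p in square t) (cst 1%E p))%E).
  apply: ge0_le_integral => //.
  - exact: measurable_square.
  - by move=> x _; rewrite lee_fin pdf_ge0.
  - move=> x _; rewrite lee_fin /std_complex_normal_pdf.
    rewrite -[leRHS]mulr1 ler_pM ?expR_ge0 ?invr_ge0 ?pi_ge0//.
      by rewrite invf_le1 ?pi_gt0// (le_trans _ (@pi_ge2 R))// ler1n.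
    rewrite -expR0 ler_expR oppr_le0 addr_ge0 ?sqr_ge0//.
rewrite integral_cst//; last exact: measurable_square.
by rewrite [X in (_ * X <= _)%E](square_measure t0) mul1e.
Qed.

Definition gauss_const : R := pi^-1 * expR (- 1).

Lemma gauss_const_gt0 : 0 < gauss_const.
Proof. by rewrite mulr_gt0 ?expR_gt0// invr_gt0 pi_gt0. Qed.

(** The disk contains a square of area t^2, on which the density is at least
    [gauss_const] because t <= 1. *)
Lemma gauss_disk_lb (t : R) : 0 <= t <= 1 ->
  ((gauss_const * t ^+ 2)%:E <= \int[mu2]_(p in disk t) (pdf p)%:E)%E.
Proof.
move=> /andP[t0 t1]; pose h := t / 2; have h0 : 0 <= h by rewrite /h; lra.
have mf D : measurable_fun (D : set plane) (fun p : plane => (pdf p)%:E).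
  exact: measurable_funTS measurable_Epdf.
have sub (p : plane) : square h p -> p.1 ^+ 2 + p.2 ^+ 2 <= t ^+ 2.
  move/square_mem => [p1 p2].
  have q1 : p.1 ^+ 2 <= h ^+ 2 by rewrite -real_normK ?num_real// ler_sqr ?nnegrE.
  have q2 : p.2 ^+ 2 <= h ^+ 2 by rewrite -real_normK ?num_real// ler_sqr ?nnegrE.
  have : h ^+ 2 = t ^+ 2 / 4 by rewrite /h; field.
  by have := sqr_ge0 t; lra.
apply: (@le_trans _ _ (\int[mu2]_(p in square h) (pdf p)%:E)%E); last first.
  apply: ge0_subset_integral => //.
  - exact: measurable_square.
  - exact: measurable_disk.
  - by move=> x _; rewrite lee_fin pdf_ge0.
apply: (@le_trans _ _ (\int[mu2]_(p in square h) (cst gauss_const%:E p))%E).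
  rewrite integral_cst//; last exact: measurable_square.
  rewrite [X in (_ <= _ * X)%E](square_measure h0) -EFinM lee_fin le_eqVlt; apply/orP; left; apply/eqP.
  by rewrite /h; field.
apply: ge0_le_integral => //.
- exact: measurable_square.
- by move=> x _; rewrite lee_fin ltW// gauss_const_gt0.
- move=> x /sub xh; rewrite lee_fin /gauss_const /std_complex_normal_pdf.
  rewrite ler_wpM2l ?invr_ge0 ?pi_ge0// ler_expR lerN2 (le_trans xh)//.
  by rewrite expr_le1.
Qed.

(** The integrand is 2 times a product of two standard normal densities, so that
    no polar coordinates are needed. *)
Lemma gauss_total_half :
  (\int[mu2]_p ((pi^-1 * expR (- (p.1 ^+ 2 + p.2 ^+ 2) / 2))%:E) = 2%:E)%E.
Proof.
pose g (x : R) := normal_pdf 0 1 x.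
have gE x : g x = normal_peak 1 * expR (- x ^+ 2 / 2).
  by rewrite /g /normal_pdf oner_eq0 /= /normal_fun subr0 expr1n.
have pk : normal_peak 1 ^+ 2 = (2 * pi)^-1 :> R.
  rewrite /normal_peak exprVn sqr_sqrtr expr1n ?mul1r ?mulr_natl//.
  by rewrite mulrn_wge0// pi_ge0.
have E (p : plane) : (pi^-1 * expR (- (p.1 ^+ 2 + p.2 ^+ 2) / 2))%:E =
    (2%:E * ((g p.1)%:E * (g p.2)%:E))%E :> \bar R.
  rewrite -!EFinM; congr EFin; rewrite !gE mulrACA -expr2 pk opprD mulrDl expRD.
  have -> : (pi : R)^-1 = 2 * (2 * pi)^-1.
    by rewrite invfM mulrA mulfV ?mul1r// pnatr_eq0.
  by rewrite [RHS]mulrA.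
under eq_integral do rewrite E.
have mg : measurable_fun setT g by exact: measurable_normal_pdf.
have mgg : measurable_fun [set: plane] (fun p : plane => (g p.1)%:E * (g p.2)%:E)%E.
  under eq_fun do rewrite -EFinM.
  apply/measurable_EFinP; apply: measurable_funM.
    by apply: (measurableT_comp mg); exact: measurable_fst.
  by apply: (measurableT_comp mg); exact: measurable_snd.
have gg0 (p : plane) : (0 <= (g p.1)%:E * (g p.2)%:E)%E.
  by rewrite mule_ge0// lee_fin normal_pdf_ge0.
rewrite ge0_integralZl_EFin//.
rewrite fubini_tonelli1// /fubini_F /=.
under eq_integral => x _.
  rewrite ge0_integralZl_EFin//; last 3 first.
  - by move=> y _; rewrite lee_fin normal_pdf_ge0.
  - by apply/measurable_EFinP.
  - exact: normal_pdf_ge0.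
  rewrite integral_normal_pdf mule1.
  over.
by rewrite integral_normal_pdf mule1.
Qed.

(** Half of the exponent is at least t^2 / 2 outside the disk, and the other half
    is integrated. *)
Lemma gauss_tail (t : R) : 0 <= t ->
  (\int[mu2]_(p in ~` disk t) (pdf p)%:E <= (2 * expR (- (t ^+ 2 / 2)))%:E)%E.
Proof.
move=> t0; pose f (p : plane) : \bar R := (pi^-1 * expR (- (p.1 ^+ 2 + p.2 ^+ 2) / 2))%:E.
have mf : measurable_fun [set: plane] f.
  apply/measurable_EFinP; apply: measurable_funM; first exact: measurable_cst.
  apply: measurableT_comp; first exact: measurable_expR.
  apply: measurable_funM; last exact: measurable_cst.
  by apply: measurableT_comp; [exact: oppr_measurable|exact: measurable_sqnorm].
have f0 (p : plane) : (0 <= f p)%E by rewrite lee_fin mulr_ge0 ?expR_ge0// invr_ge0 pi_ge0.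
have mD : measurable (~` disk t) by apply: measurableC; exact: measurable_disk.
apply: (@le_trans _ _ (\int[mu2]_(p in ~` disk t) ((expR (- (t ^+ 2 / 2)))%:E * f p))%E).
  apply: ge0_le_integral => //.
  - by move=> x _; rewrite lee_fin pdf_ge0.
  - exact: measurable_funTS measurable_Epdf.
  - apply: measurable_funTS; apply: emeasurable_funM => //.
  - move=> x /= /negP; rewrite -ltNge => xt; rewrite -EFinM lee_fin.
    rewrite /std_complex_normal_pdf mulrCA -expRD ler_wpM2l ?invr_ge0 ?pi_ge0//.
    by rewrite ler_expR; lra.
rewrite ge0_integralZl_EFin ?expR_ge0//; last exact: measurable_funTS.
rewrite [(2 * _)%R]mulrC EFinM lee_wpmul2l ?lee_fin ?expR_ge0// -gauss_total_half.
by apply: ge0_subset_integral.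
Qed.

End GaussianBounds.

(** * Independent standard complex normal coefficients *)
Section Coefficients.
Context (R : realType) (d : measure_display) (T : measurableType d).
Context (P : probability T R) (a : nat -> T -> R[i]).
Hypothesis a_normal : forall n, std_complex_normal P (a n).
Hypothesis a_indep : mutually_independent P a.
Local Notation plane := (measurableTypeR R * measurableTypeR R)%type.

Lemma disk_nrm (t : R) (z : R[i]) : 0 <= t -> disk t (to_plane z) <-> nrm z <= t.
Proof.
move=> t0; rewrite /disk /to_plane /= -sqr_nrm ler_sqr ?nnegrE//; exact: nrm_ge0.
Qed.

Lemma measurable_coef n (A : set plane) : measurable A ->
  measurable [set w | A (to_plane (a n w))].
Proof.
move=> mA; have [mX _] := a_normal n.
by have := mX measurableT _ mA; rewrite setTI.
Qed.

Lemma measurable_coef_bigcap (s : seq nat) (A : nat -> set plane) :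
  (forall n, measurable (A n)) ->
  measurable (\bigcap_(n in [set` s]) [set w | A n (to_plane (a n w))]).
Proof.
by move=> mA; apply: fin_bigcap_measurable => // n _; exact: measurable_coef.
Qed.

Lemma prob_disk_ub n (t : R) : 0 <= t ->
  (P [set w | disk t (to_plane (a n w))] <= (4 * t ^+ 2)%:E)%E.
Proof.
move=> t0; have [_ ->] := a_normal n; last exact: measurable_disk.
exact: gauss_disk_ub.
Qed.

Lemma prob_disk_lb n (t : R) : 0 <= t <= 1 ->
  ((gauss_const R * t ^+ 2)%:E <= P [set w | disk t (to_plane (a n w))])%E.
Proof.
move=> t0; have [_ ->] := a_normal n; last exact: measurable_disk.
exact: gauss_disk_lb.
Qed.

Lemma prob_tail n (t : R) : 0 <= t ->
  (P [set w | (~` disk t) (to_plane (a n w))] <= (2 * expR (- (t ^+ 2 / 2)))%:E)%E.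
Proof.
move=> t0; have [_ ->] := a_normal n; last by apply: measurableC; exact: measurable_disk.
exact: gauss_tail.
Qed.

Lemma nneseries_le (f : nat -> \bar R) (c : \bar R) : (forall n, 0 <= f n)%E ->
  (forall n, \sum_(0 <= k < n) f k <= c)%E -> (\sum_(k <oo) f k <= c)%E.
Proof.
move=> f0 fc; apply: lime_le; first exact: is_cvg_nneseries.
by near=> n; exact: fc.
Unshelve. all: by end_near. Qed.

(** Since 4^k >= k + 1, the terms are dominated by a geometric progression of
    ratio exp (- K^2 / 2) <= 1/2. *)
Lemma gauss_tail_sum (K : R) n : expR (- (K ^+ 2 / 2)) <= 2^-1 ->
  \sum_(0 <= k < n) 2 * expR (- ((K * 2 ^+ k) ^+ 2 / 2)) <= 4 * expR (- (K ^+ 2 / 2)).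
Proof.
set x := expR _ => x2; have x0 : 0 <= x by exact: expR_ge0.
apply: (@le_trans _ _ (\sum_(0 <= k < n) (2 * x) * x ^+ k)).
  apply: ler_sum => k _; rewrite -mulrA -exprS ler_wpM2l// /x -expRM_natl.
  rewrite ler_expR mulrN lerN2.
  have h : k.+1%:R <= 2 ^+ k :> R by rewrite -natrX ler_nat ltn_expl.
  have h1 : 1 <= 2 ^+ k :> R by rewrite (le_trans _ h)// ler1n.
  have h2 : k.+1%:R <= (2 ^+ k) ^+ 2 :> R.
    by rewrite (le_trans h)// expr2 ler_peMr// (le_trans ler01).
  have K2 : 0 <= K ^+ 2 / 2 by rewrite divr_ge0// sqr_ge0.
  apply: le_trans (ler_wpM2r K2 h2) _.
  by rewrite le_eqVlt; apply/orP; left; apply/eqP; field.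
rewrite -mulr_sumr.
apply: (@le_trans _ _ (2 * x * 2)); last by rewrite mulrAC -natrM.
rewrite ler_wpM2l ?mulr_ge0//.
apply: (le_trans (geo_series_le _ _)); first by rewrite x0/= (le_lt_trans x2)// invf_lt1 ?ltr1n.
by rewrite -[leRHS]invrK lef_pV2 ?posrE ?invr_gt0//; lra.
Qed.

Lemma measurable_coef_disk n t : measurable [set w | disk t (to_plane (a n w))].
Proof. by apply: measurable_coef; exact: measurable_disk. Qed.

Lemma prob_union_tail (K : R) : 0 <= K -> expR (- (K ^+ 2 / 2)) <= 2^-1 ->
  (P (\bigcup_n [set w | (~` disk (K * 2 ^+ n)) (to_plane (a n w))])
    <= (4 * expR (- (K ^+ 2 / 2)))%:E)%E.
Proof.
move=> K0 K2.
have mA n : measurable [set w | (~` disk (K * 2 ^+ n)) (to_plane (a n w))].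
  by apply: measurable_coef; apply: measurableC; exact: measurable_disk.
apply: le_trans (measure_sigma_subadditive _ _ _ (@subset_refl _ _)) _.
- exact: mA.
- exact: bigcup_measurable.
apply: nneseries_le => // n.
apply: (@le_trans _ _ (\sum_(0 <= k < n) (2 * expR (- ((K * 2 ^+ k) ^+ 2 / 2)))%:E)%E).
  by apply: lee_sum => k _; apply: prob_tail; rewrite mulr_ge0// exprn_ge0.
by rewrite sumEFin lee_fin; exact: gauss_tail_sum.
Qed.

Lemma prob_indep_ub N (t : nat -> R) : (forall n, 0 <= t n) ->
  (P (\bigcap_(n in [set` iota 0 N]) [set w | disk (t n) (to_plane (a n w))])
    <= (\prod_(n <- iota 0 N) (4 * t n ^+ 2))%:E)%E.
Proof.
move=> t0; rewrite (@a_indep _ (fun n => disk (t n))) ?iota_uniq//; last first.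
  by move=> n; exact: measurable_disk.
rewrite -prodEFin; elim: (iota 0 N) => [|n s IH]; first by rewrite !big_nil.
rewrite !big_cons; apply: lee_pmul => //; last exact: prob_disk_ub.
by rewrite big_seq; elim/big_ind: _ => // x y; exact: mule_ge0.
Qed.

Lemma prod_lb (s : seq nat) (f : nat -> R) (g : nat -> \bar R) :
  (forall n, n \in s -> 0 <= f n /\ ((f n)%:E <= g n)%E) ->
  ((\prod_(n <- s) f n)%:E <= \prod_(n <- s) g n)%E.
Proof.
elim: s => [|n s IH] h; first by rewrite !big_nil.
rewrite !big_cons EFinM; have [f0 fg] := h n (mem_head _ _).
apply: lee_pmul => //.
  rewrite lee_fin big_seq prodr_ge0// => k ks.
  by case: (h k) => //; rewrite inE ks orbT.
by apply: IH => k ks; apply: h; rewrite inE ks orbT.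
Qed.

(** A box of coefficients of which the one of index N is not small, the earlier
    ones are prescribed to be small, and the later ones grow moderately. The
    constant 4 makes the last condition likely. *)
Definition coef_box N (t : nat -> R) (n : nat) : set plane :=
  if (n < N)%N then disk (t n) else if n == N then ~` disk 4^-1
  else disk (4 * 2 ^+ (n - N.+1)).

Lemma measurable_coef_box N t n : measurable (coef_box N t n).
Proof.
rewrite /coef_box; case: ifP => _; first exact: measurable_disk.
by case: ifP => _; first apply: measurableC; exact: measurable_disk.
Qed.

Lemma expRN8_le : expR (- 8 : R) <= 9^-1.
Proof.
rewrite expRN lef_pV2 ?posrE ?expR_gt0//.
by apply: le_trans (expR_ge1Dx 8); lra.
Qed.

(** Only finitely many coefficients may be multiplied together. The infinitely
    many conditions of index greater than N are handled by a union bound inside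
    the event F that involves the indices up to N; as F is independent of each
    of them, the failures have probability at most 4 exp (- 8) P(F) in total. *)
Lemma prob_coef_box_lb N (t : nat -> R) : (forall n, 0 <= t n <= 1) ->
  ((4^-1 * \prod_(n <- iota 0 N) (gauss_const R * t n ^+ 2))%:E <=
    P (\bigcap_n [set w | coef_box N t n (to_plane (a n w))]))%E.
Proof.
move=> t01.
set G := \bigcap_n _.
have mG : measurable G.
  by apply: bigcapT_measurable => n; apply: measurable_coef; exact: measurable_coef_box.
pose F := \bigcap_(n in [set` iota 0 N.+1]) [set w | coef_box N t n (to_plane (a n w))].
have mF : measurable F.
  by apply: measurable_coef_bigcap => n; exact: measurable_coef_box.
pose p := fine (P F).
have pE : P F = p%:E by rewrite fineK// fin_num_measure.
have p0 : 0 <= p by rewrite -lee_fin -pE.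
pose B k := F `&` [set w | (~` disk (4 * 2 ^+ k)) (to_plane (a (N.+1 + k)%N w))].
have mB k : measurable (B k).
  apply: measurableI => //; apply: measurable_coef; apply: measurableC.
  exact: measurable_disk.
have PB k : (P (B k) <= (p * (2 * expR (- ((4 * 2 ^+ k) ^+ 2 / 2))))%:E)%E.
  pose A' n := if n == (N.+1 + k)%N then ~` disk (4 * 2 ^+ k) else coef_box N t n.
  have mA' n : measurable (A' n).
    rewrite /A'; case: ifP => _; last exact: measurable_coef_box.
    by apply: measurableC; exact: measurable_disk.
  have uS : uniq ((N.+1 + k)%N :: iota 0 N.+1).
    rewrite cons_uniq iota_uniq andbT mem_iota add0n /=.
    by rewrite -leqNgt leq_addr.
  have A'E n : n \in iota 0 N.+1 -> A' n = coef_box N t n.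
    rewrite mem_iota add0n /= /A' => nN; case: eqP => // nE.
    by move: nN; rewrite nE ltnNge leq_addr.
  have -> : B k = \bigcap_(n in [set` (N.+1 + k)%N :: iota 0 N.+1])
      [set w | A' n (to_plane (a n w))].
    apply/seteqP; split => w.
      move=> [Fw Bw] n /=; rewrite inE => /orP[/eqP ->|nN].
        by rewrite /A' eqxx.
      by rewrite A'E//; exact: Fw.
    move=> h; split.
      move=> n nN /=; rewrite -A'E//; apply: (h n).
      by rewrite /= inE; apply/orP; right.
    have := h (N.+1 + k)%N; rewrite /A' eqxx; apply.
    by rewrite /= inE eqxx.
  rewrite (a_indep uS mA') big_cons muleC EFinM.
  have -> : (\prod_(n <- iota 0 N.+1) P [set w | A' n (to_plane (a n w))])%E = P F.
    rewrite /F (a_indep (iota_uniq 0 N.+1) (measurable_coef_box N t)).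
    by apply: eq_big_seq => n nN; rewrite A'E.
  rewrite pE; apply: lee_wpmul2l; first by rewrite lee_fin.
  by rewrite /A' eqxx; apply: prob_tail; rewrite mulr_ge0// exprn_ge0.
have FG : F `<=` G `|` \bigcup_k B k.
  move=> w Fw; have [Gw|nG] := pselect (G w); [by left|right].
  have [n [_ nw]] : exists n, True /\ ~ coef_box N t n (to_plane (a n w)).
    apply: contrapT => /forallNP h; apply: nG => n _ /=; apply: contrapT => hh.
    by apply: (h n).
  have Nn : (N < n)%N.
    rewrite ltnNge; apply/negP => nN; apply: nw; apply: (Fw n).
    by suff : n \in iota 0 N.+1 by []; rewrite mem_iota add0n.
  exists (n - N.+1)%N => //; split => //=.
  rewrite subnKC//; move: nw; rewrite /coef_box ltnNge (ltnW Nn) /=.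
  by rewrite gtn_eqF.
have PF : (P F <= P G + (p * (4 * expR (- 8)))%:E)%E.
  apply: (@le_trans _ _ (P (G `|` \bigcup_k B k))).
    by apply: le_measure; rewrite ?inE//; apply: measurableU => //; exact: bigcup_measurable.
  apply: le_trans (measureU2 _ _ _) _ => //; first exact: bigcup_measurable.
  apply: leeD2l.
  apply: le_trans (measure_sigma_subadditive _ _ _ (@subset_refl _ _)) _ => //.
    exact: bigcup_measurable.
  apply: nneseries_le => // n.
  apply: le_trans (lee_sum _ (fun k _ => PB k)) _.
  rewrite sumEFin lee_fin -mulr_sumr ler_wpM2l//.
  have e8 : (4 : R) ^+ 2 / 2 = 8 by lra.
  have := @gauss_tail_sum 4 n; rewrite e8; apply.
  by apply: (le_trans expRN8_le); lra.
(* 1 - 4 exp (- 8) >= 5/9, and 3/4 * 5/9 >= 1/4 below. *)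
have PG : ((p * (5 / 9))%:E <= P G)%E.
  rewrite -(fineK (fin_num_measure P _ mG)) in PF *.
  move: PF; rewrite pE -EFinD !lee_fin => PF.
  have : p * (4 * expR (- 8)) <= p * (4 / 9).
    by rewrite ler_wpM2l//; have := expRN8_le; lra.
  lra.
have PF_lb : ((3 / 4 * \prod_(n <- iota 0 N) (gauss_const R * t n ^+ 2))%:E <= P F)%E.
  rewrite /F (a_indep (iota_uniq 0 N.+1) (measurable_coef_box N t)).
  rewrite -[N.+1]addn1 iotaD add0n big_cat big_seq1 /= muleC EFinM.
  apply: lee_pmul.
  - by rewrite lee_fin; lra.
  - by rewrite lee_fin prodr_ge0// => n _; rewrite mulr_ge0 ?sqr_ge0// ltW// gauss_const_gt0.
  - rewrite {1}/coef_box ltnn eqxx.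
    have mD : measurable [set w | disk 4^-1 (to_plane (a N w))].
      exact: measurable_coef_disk.
    rewrite (_ : [set w | _] = ~` [set w | disk 4^-1 (to_plane (a N w))])//.
    rewrite probability_setC//.
    rewrite -(fineK (fin_num_measure P _ mD)) -EFinB lee_fin.
    have : (P [set w | disk 4^-1 (to_plane (a N w))] <= (4 * 4^-1 ^+ 2)%:E)%E.
      by apply: prob_disk_ub; rewrite invr_ge0.
    rewrite -[X in (X <= _)%E](fineK (fin_num_measure P _ mD)) lee_fin.
    have -> : (4 * 4^-1 ^+ 2 : R) = 4^-1 by field.
    lra.
  - apply: prod_lb => n; rewrite mem_iota add0n /= => nN; split.
      by rewrite mulr_ge0 ?sqr_ge0// ltW// gauss_const_gt0.
    by rewrite /coef_box nN; exact: prob_disk_lb.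
apply: le_trans PG; rewrite lee_fin; move: PF_lb; rewrite pE lee_fin.
have : 0 <= \prod_(n <- iota 0 N) (gauss_const R * t n ^+ 2).
  by apply: prodr_ge0 => n _; rewrite mulr_ge0 ?sqr_ge0// ltW// gauss_const_gt0.
lra.
Qed.

End Coefficients.

(** * Measurability of the number of zeros *)
Section MeasurableComplex.
Context (R : realType) (d : measure_display) (T : measurableType d).
Implicit Types (X Y : T -> R[i]) (c : nat -> T -> R[i]).

(** Measurability of a complex random variable, in coordinates. *)
Definition measurableCx X := measurable_fun [set: T] (fun w => complex.Re (X w)) /\
  measurable_fun [set: T] (fun w => complex.Im (X w)).

Lemma measurableCx_cst z : measurableCx (fun=> z).
Proof. by split; exact: measurable_cst. Qed.

Lemma measurableCxD X Y :
  measurableCx X -> measurableCx Y -> measurableCx (fun w => X w + Y w).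
Proof.
move=> [X1 X2] [Y1 Y2]; split.
  by under eq_fun do rewrite ReD; exact: measurable_funD.
by under eq_fun do rewrite ImD; exact: measurable_funD.
Qed.

Lemma measurableCxM X Y :
  measurableCx X -> measurableCx Y -> measurableCx (fun w => X w * Y w).
Proof.
move=> [X1 X2] [Y1 Y2]; split.
  have E w : complex.Re (X w * Y w) =
      complex.Re (X w) * complex.Re (Y w) - complex.Im (X w) * complex.Im (Y w).
    by case: (X w); case: (Y w).
  under eq_fun do rewrite E.
  by apply: measurable_funB; exact: measurable_funM.
have E w : complex.Im (X w * Y w) =
    complex.Re (X w) * complex.Im (Y w) + complex.Im (X w) * complex.Re (Y w).
  by case: (X w); case: (Y w).
under eq_fun do rewrite E.
by apply: measurable_funD; exact: measurable_funM.
Qed.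

Lemma measurableCx_nrm X : measurableCx X -> measurable_fun [set: T] (fun w => nrm (X w)).
Proof.
move=> [X1 X2].
have E w : nrm (X w) = Num.sqrt (complex.Re (X w) ^+ 2 + complex.Im (X w) ^+ 2).
  by rewrite /nrm normc_def.
under eq_fun do rewrite E.
apply: (@measurableT_comp _ _ _ _ _ _ (@Num.sqrt R)).
  by apply: continuous_measurable_fun; exact: sqrt_continuous.
by apply: measurable_funD; exact: measurable_funX.
Qed.

Lemma measurable_nrm_lt X (e : R) : measurableCx X -> measurable [set w | nrm (X w) < e].
Proof.
move=> mX; have := measurableCx_nrm mX measurableT (measurable_itv `]-oo, e[).
by rewrite setTI; congr measurable; apply/seteqP; split => p /=; rewrite in_itv.
Qed.

Lemma measurable_nrm_le X (e : R) : measurableCx X -> measurable [set w | nrm (X w) <= e].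
Proof.
move=> mX; have := measurableCx_nrm mX measurableT (measurable_itv `]-oo, e]).
by rewrite setTI; congr measurable; apply/seteqP; split => p /=; rewrite in_itv.
Qed.

Lemma measurableCx_csum (u : nat -> T -> R[i]) : (forall n, measurableCx (u n)) ->
  (forall w, exists q M : R, 0 <= q < 1 /\ geo_bounded q M (u^~ w)) ->
  measurableCx (fun w => csum (u^~ w)).
Proof.
move=> mu hu.
have mS n : measurableCx (fun w => series (u^~ w) n).
  rewrite /series /=; elim: n => [|n IH].
    under eq_fun do rewrite big_geq//; exact: measurableCx_cst.
  under eq_fun do rewrite big_nat_recr//=; exact: measurableCxD.
have cv w : nrm (series (u^~ w) n - csum (u^~ w)) @[n --> \oo] --> (0 : R).
  have [q [M [q01 uM]]] := hu w; apply/cvgC_nrm; exact: csum_cvg q01 uM.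
have aux (f : R[i] -> R) : (forall z z', f (z - z') = f z - f z') ->
    (forall z, `|f z| <= nrm z) ->
    forall w, (f (series (u^~ w) n)) @[n --> \oo] --> f (csum (u^~ w)).
  move=> fB fN w; apply/subr_cvg0; apply/norm_cvg0P.
  apply: (@squeeze_cvgr _ _ _ _ (cst 0)
    (fun n => nrm (series (u^~ w) n - csum (u^~ w)))); [|exact: cvg_cst|exact: cv].
  by near=> n; rewrite normr_ge0 /= -fB fN.
split.
  apply: (@measurable_fun_cvg _ _ _ _ (fun n w => complex.Re (series (u^~ w) n))).
    by move=> n; case: (mS n).
  move=> w _; apply: aux; last exact: Re_le_nrm.
  by case=> ? ? [].
apply: (@measurable_fun_cvg _ _ _ _ (fun n w => complex.Im (series (u^~ w) n))).
  by move=> n; case: (mS n).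
move=> w _; apply: aux; last exact: Im_le_nrm.
by case=> ? ? [].
Unshelve. all: by end_near. Qed.

Lemma measurableCx_pseval c z :
  (forall n, measurableCx (c n)) -> (forall w, entire (c^~ w)) ->
  measurableCx (fun w => pseval (c^~ w) z).
Proof.
move=> mc ec; apply: measurableCx_csum => [n|w].
  by apply: measurableCxM => //; exact: measurableCx_cst.
have zs : nrm z < nrm z + 1 by rewrite ltrDl.
have s0 : 0 < nrm z + 1 by apply: le_lt_trans zs; exact: nrm_ge0.
have [M cM] := entireE s0 (ec w).
by exists (nrm z / (nrm z + 1)), M; split; [exact: ratio_itv|exact: geo_bounded_pseval].
Qed.

Lemma measurableCx_psquot c z k :
  (forall n, measurableCx (c n)) -> (forall w, entire (c^~ w)) ->
  measurableCx (fun w => psquot z (c^~ w) k).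
Proof.
move=> mc ec; apply: measurableCx_csum => [n|w].
  by apply: measurableCxM => //; exact: measurableCx_cst.
have zs : nrm z < nrm z + 1 by rewrite ltrDl.
have s0 : 0 < nrm z + 1 by apply: le_lt_trans zs; exact: nrm_ge0.
have [M cM] := entireE s0 (ec w).
exists (nrm z / (nrm z + 1)), (M / (nrm z + 1) ^+ k.+1).
by split; [exact: ratio_itv|exact: (@geo_bounded_psquot _ _ _ (c^~ w) z k zs cM)].
Qed.

(** The points range over a countable set, so each step of the recursion is a
    countable union. *)
Lemma measurable_near_zeros (f : nat -> R[i]) (rho e : R) N c :
  (forall n, measurableCx (c n)) -> (forall w, entire (c^~ w)) ->
  measurable [set w | near_zeros [set z | nrm z <= rho /\ exists i, z = f i] N e (c^~ w)].
Proof.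
pose S : set R[i] := [set z | nrm z <= rho /\ exists i, z = f i].
rewrite -/S; elim: N c => [|N IH] c mc ec.
  by rewrite (_ : [set w | _] = setT)//; apply/seteqP; split.
rewrite (_ : [set w | _] = \bigcup_(i in [set i | S (f i)])
   ([set w | nrm (pseval (c^~ w) (f i)) < e] `&`
    [set w | near_zeros S N e (psquot (f i) (c^~ w))])); last first.
  apply/seteqP; split => w /=.
    by move=> [z [[zr [i zi]] cz h]]; exists i; rewrite /= -zi//; split=> //; exists i.
  by move=> [i Si [h1 h2]]; exists (f i); split.
apply: bigcup_measurable => i _; apply: measurableI.
  by apply: measurable_nrm_lt; exact: measurableCx_pseval.
apply: (IH (fun k w => psquot (f i) (c^~ w) k)) => [n|w].
  exact: measurableCx_psquot.
exact: entire_psquot.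
Qed.

Definition ratC (n : nat) : R[i] :=
  if @unpickle (rat * rat)%type n is Some (p, q) then ratr p +i* ratr q else 0.

Lemma ratC_dense (z : R[i]) (dl : R) : 0 < dl -> exists i, nrm (ratC i - z) < dl.
Proof.
move=> dl0; have h x : exists q : rat, `|ratr q - x| < dl / 2.
  have [|q] := @rat_in_itvoo R x (x + dl / 2); first by rewrite ltrDl divr_gt0.
  rewrite in_itv /= => /andP[q1 q2]; exists q.
  by rewrite gtr0_norm ?subr_gt0// ltrBlDl.
have [p hp] := h (complex.Re z); have [q hq] := h (complex.Im z).
exists (pickle (p, q)); rewrite /ratC pickleK.
apply: le_lt_trans (nrm_le_ReIm _) _; rewrite [ltRHS]splitr.
by case: z hp hq => x y /= hp hq; rewrite ltrD.
Qed.

(** Finitely many zeros in an open disk lie in a smaller disk, which leaves room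
    for compactness. *)
Lemma has_zeros_shrink N (r : R) (c : nat -> R[i]) : 0 < r -> has_zeros N r c ->
  exists2 r', 0 < r' < r & has_zeros N r' c.
Proof.
move=> r0; elim: N c => [|N IH] c /=.
  by move=> _; exists (r / 2) => //; apply/andP; split; lra.
move=> [w [wr cw h]]; have [r' /andP[r'0 r'r] h'] := IH _ h.
exists (Num.max r' ((nrm w + r) / 2)).
  by rewrite lt_max r'0 gt_max r'r /=; lra.
exists w; split=> //; last by apply: has_zeros_sub h'; rewrite le_max lexx.
by rewrite lt_max; apply/orP; right; lra.
Qed.

(** Zeros in the open disk of radius r are zeros in one of the disks of radius
    rho_k < r, and those are detected by approximate zeros at rational points. *)
Lemma measurable_has_zeros N (r : R) c : 0 < r ->
  (forall n, measurableCx (c n)) -> (forall w, entire (c^~ w)) ->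
  measurable [set w | has_zeros N r (c^~ w)].
Proof.
move=> r0 mc ec; pose rho k : R := r - r / k.+2%:R.
have rho0 k : 0 < rho k.
  by rewrite subr_gt0 ltr_pdivrMr// ltr_pMr// ltr1n.
have rhor k : rho k < r by rewrite ltrBlDr ltrDl divr_gt0.
pose S k := [set z : R[i] | nrm z <= rho k /\ exists i, z = ratC i].
rewrite (_ : [set w | _] = \bigcup_k \bigcap_m
    [set w | near_zeros (S k) N m.+1%:R^-1 (c^~ w)]).
  apply: bigcupT_measurable => k; apply: bigcapT_measurable => m.
  exact: measurable_near_zeros.
apply/seteqP; split => w /=.
  move=> h; have [r' /andP[r'0 r'r] h'] := has_zeros_shrink r0 h.
  pose k := Num.truncn (r / (r - r')).
  have kr : r' <= rho k.
    rewrite lerBrDr -lerBrDl ler_pdivrMr// mulrC -ler_pdivrMr ?subr_gt0//.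
    apply: le_trans (ltW (truncnS_gt _)) _; by rewrite ler_nat.
  exists k => // m _ /=.
  have [M cM] := entireE r0 (ec w).
  apply: (has_zeros_near (rho := rho k) (s := r) (M := M)) => //.
  - by rewrite (ltW (rho0 k)) rhor.
  - by move=> z [].
  - move=> z dl zr dl0.
    have [|i hi] := ratC_dense z (_ : 0 < Num.min dl (rho k - nrm z)).
      by rewrite lt_min dl0 subr_gt0.
    move: hi; rewrite lt_min => /andP[i1 i2]; exists (ratC i) => //.
    split; last by exists i.
    rewrite -[ratC i](subrK z); apply: le_trans (ler_nrmD _ _) _; lra.
  - exact: has_zeros_sub h'.
move=> [k _ h]; have [M cM] := entireE r0 (ec w).
apply: (near_zeros_closed (S := S k) (rho := rho k) (s := r) (M := M)) => //.
- by rewrite (ltW (rho0 k)) rhor.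
- by move=> z [].
- move=> e e0.
  have me : (Num.truncn e^-1).+1%:R^-1 <= e.
    by rewrite invf_ple ?posrE// ltW// truncnS_gt.
  by apply: near_zeros_mono me _; exact: (h (Num.truncn e^-1)).
Qed.

(** Boundedness of |c_n| m^n for every integer m is enough. *)
Lemma measurable_entire c : (forall n, measurableCx (c n)) ->
  measurable [set w | entire (c^~ w)].
Proof.
move=> mc.
rewrite (_ : [set w | _] = \bigcap_m \bigcup_K \bigcap_n
    [set w | nrm (m.+1%:R ^+ n * c n w) <= K%:R]).
  apply: bigcapT_measurable => m; apply: bigcupT_measurable => K.
  apply: bigcapT_measurable => n; apply: measurable_nrm_le.
  by apply: measurableCxM => //; exact: measurableCx_cst.
have E m n w : nrm (m.+1%:R ^+ n * c n w) = nrm (c n w) * m.+1%:R ^+ n.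
  by rewrite nrmM nrmX nrm_nat mulrC.
apply/seteqP; split => w /=.
  move=> ec m _; have [|M cM] := ec m.+1%:R; first by [].
  exists (Num.truncn M).+1 => // n _ /=; rewrite E.
  by apply: (le_trans (cM n)); rewrite ltW// truncnS_gt.
move=> h s s0; have [K _ hK] := h (Num.truncn s) I.
exists K%:R; apply: (@coef_bounded_mono _ s (Num.truncn s).+1%:R); first exact: ltW.
  by rewrite ltW// truncnS_gt.
by move=> n; rewrite -E; exact: hK.
Qed.

End MeasurableComplex.

(** * The planar series *)
Section PlanarSeries.
Variable R : realType.
Implicit Types (c : nat -> R[i]) (s M : R).

Definition sqrt_fact (n : nat) : R := Num.sqrt n`!%:R.

Lemma sqrt_fact_gt0 n : 0 < sqrt_fact n.
Proof. by rewrite sqrtr_gt0 ltr0n fact_gt0. Qed.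

Lemma sqr_sqrt_fact n : sqrt_fact n ^+ 2 = n`!%:R.
Proof. by rewrite sqr_sqrtr. Qed.

Definition gaf_coef c : nat -> R[i] := fun n => c n / (sqrt_fact n)%:C.

Lemma nrm_gaf_coef c n : nrm (gaf_coef c n) = nrm (c n) / sqrt_fact n.
Proof. by rewrite nrmM nrmV nrmR gtr0_norm// sqrt_fact_gt0. Qed.

Lemma planar_termsE c z : planar_terms c z = (fun n => gaf_coef c n * z ^+ n).
Proof. by apply/funext => n; rewrite /planar_terms /gaf_coef mulrAC. Qed.

(** The terms of a convergent series are bounded; at the real points this bounds
    the coefficients. *)
Lemma cvg_planar_terms_entire c :
  (forall y, cvgn (series (planar_terms c y))) <-> entire (gaf_coef c).
Proof.
split=> [h s s0|h y].
  have hs := h s%:C; have := cvg_series_cvg_0 hs.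
  rewrite planar_termsE => /cvgC_nrm.
  have E n : nrm (gaf_coef c n * s%:C ^+ n - 0) = nrm (gaf_coef c n) * s ^+ n.
    by rewrite subr0 nrmM nrmX nrmR gtr0_norm.
  under eq_fun do rewrite E.
  move=> cv.
  have /cvg_seq_bounded [B [_ hB]] : cvgn (fun n => nrm (gaf_coef c n) * s ^+ n).
    by apply/cvg_ex; exists 0.
  have BB : B < B + 1 by rewrite ltrDl.
  exists (B + 1) => n; have := hB _ BB n Logic.I.
  by apply: le_trans; exact: ler_norm.
have ys : nrm y < nrm y + 1 by rewrite ltrDl.
have s0 : 0 < nrm y + 1 by apply: le_lt_trans ys; exact: nrm_ge0.
have [M cM] := entireE s0 h.
by rewrite planar_termsE; exact: geo_bounded_cvg (ratio_itv ys) (geo_bounded_pseval ys cM).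
Qed.

(** The coefficients of [planar_gaf]: they are 0 when the series does not converge
    everywhere, so that one always has an entire series. *)
Definition gaf_series c : nat -> R[i] :=
  if `[< entire (gaf_coef c) >] then gaf_coef c else (fun=> 0).

Lemma entire0 : entire (fun=> 0 : R[i]).
Proof. by move=> s _; exists 0 => n; rewrite nrm0 mul0r. Qed.

Lemma entire_gaf_series c : entire (gaf_series c).
Proof. by rewrite /gaf_series; case: asboolP => // _; exact: entire0. Qed.

Lemma planar_gafE c : planar_gaf c = pseval (gaf_series c).
Proof.
apply/funext => z; rewrite /planar_gaf /gaf_series (asbool_equiv_eq (cvg_planar_terms_entire c)).
case: asboolP => _; first by rewrite planar_termsE.
rewrite /pseval (_ : (fun n => _) = fun=> 0) ?csum0//.
by apply/funext => n; rewrite mul0r.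
Qed.

Lemma pow_sqrt_fact_le (x : R) n : 0 <= x -> x ^+ n / sqrt_fact n <= expR (x ^+ 2 / 2).
Proof.
move=> x0; rewrite -ler_sqr ?nnegrE ?expR_ge0 ?divr_ge0 ?exprn_ge0 ?(ltW (sqrt_fact_gt0 _))//.
rewrite expr_div_n sqr_sqrt_fact -exprM mulnC exprM -expRM_natl mulrCA divff ?mulr1//.
case: n => [|n]; first by rewrite expr0 divr1 -expR0 ler_expR sqr_ge0.
apply: le_trans (expR_ge1Dxn n (sqr_ge0 x)); rewrite lerDr//.
Qed.

Lemma gaf_coef_bounded c A s : 0 <= s -> (forall n, nrm (c n) <= A * 2 ^+ n) ->
  coef_bounded s (A * expR (2 * s ^+ 2)) (gaf_coef c).
Proof.
move=> s0 cA n; have A0 : 0 <= A.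
  by have := cA 0%N; rewrite expr0 mulr1; apply: le_trans; exact: nrm_ge0.
rewrite nrm_gaf_coef; apply: (@le_trans _ _ (A * ((2 * s) ^+ n / sqrt_fact n))).
  rewrite exprMn mulrAC -!mulrA ![_ * (_ * (sqrt_fact n)^-1)]mulrA.
  by rewrite !mulrA ler_wpM2r ?invr_ge0 ?(ltW (sqrt_fact_gt0 _))// ler_wpM2r ?exprn_ge0.
rewrite ler_wpM2l//.
have -> : 2 * s ^+ 2 = (2 * s) ^+ 2 / 2 by field.
by apply: pow_sqrt_fact_le; rewrite mulr_ge0.
Qed.

Lemma entire_gaf_coef c A : (forall n, nrm (c n) <= A * 2 ^+ n) -> entire (gaf_coef c).
Proof. by move=> cA s s0; exists (A * expR (2 * s ^+ 2)); apply: gaf_coef_bounded => //; exact: ltW. Qed.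

Lemma gaf_seriesE c : entire (gaf_coef c) -> gaf_series c = gaf_coef c.
Proof. by move=> h; rewrite /gaf_series asboolT. Qed.

Lemma fact_le_exp n N : (n <= N)%N -> (n`! <= N ^ n)%N.
Proof.
elim: n => // n IH nN; rewrite factS expnS leq_mul//; exact/IH/ltnW.
Qed.

Lemma sqrt_fact_le n N : (n <= N)%N -> sqrt_fact n <= Num.sqrt N%:R ^+ n.
Proof.
move=> nN; rewrite -ler_sqr ?nnegrE ?exprn_ge0 ?(ltW (sqrt_fact_gt0 _))//.
rewrite sqr_sqrt_fact -exprM mulnC exprM sqr_sqrtr// -natrX ler_nat.
exact: fact_le_exp.
Qed.

(** The bound on the coefficients of a series with N zeros, for s = sqrt N and
    M = e^(3N). Using s - r >= s / 2 and sqrt n! <= s^n, it takes a form in which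
    only the ratio r / sqrt N appears. *)
Lemma overcrowded_coef_le c N (r : R) n : (0 < N)%N -> 0 < r ->
  2 * r <= Num.sqrt N%:R -> (forall n, nrm (c n) <= expR N%:R * 2 ^+ n) ->
  has_zeros N r (gaf_coef c) -> (n < N)%N ->
  nrm (c n) <= (4 * expR 3) ^+ N * (r / Num.sqrt N%:R) ^+ (N - n).
Proof.
move=> N0 r0 rs cA h nN; set s := Num.sqrt N%:R in rs *.
have s0 : 0 < s by rewrite sqrtr_gt0 ltr0n.
have s2 : s ^+ 2 = N%:R by rewrite sqr_sqrtr.
have rs' : 0 <= r < s by apply/andP; split; lra.
have := has_zeros_coef_le n rs' (entire_gaf_coef cA) (gaf_coef_bounded (ltW s0) cA) h.
rewrite s2 -expRD (_ : N%:R + 2 * N%:R = N%:R * 3); last by ring.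
rewrite expRM_natl (_ : (n - N)%N = 0%N) ?expr0 ?mulr1; last first.
  by apply/eqP; rewrite subn_eq0 ltnW.
rewrite nrm_gaf_coef => h1.
have h2 : nrm (c n) / sqrt_fact n * (s / 2) ^+ N <= expR 3 ^+ N * 2 ^+ N * r ^+ (N - n).
  apply: le_trans h1; rewrite ler_wpM2l//.
    by rewrite divr_ge0 ?nrm_ge0 ?(ltW (sqrt_fact_gt0 _)).
  by rewrite lerXn2r// ?nnegrE; lra.
have sN : s ^+ N = s ^+ n * s ^+ (N - n) by rewrite -exprD subnKC// ltnW.
have rf := sqrt_fact_le (ltnW nN); rewrite -/s in rf.
have h3 : nrm (c n) * s ^+ (N - n) <= (4 * expR 3) ^+ N * r ^+ (N - n).
  rewrite expr_div_n in h2.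
  have {}h2 : nrm (c n) / sqrt_fact n * s ^+ N <= (4 * expR 3) ^+ N * r ^+ (N - n).
    move: h2; rewrite mulrA ler_pdivrMr ?exprn_gt0// => h2; apply: (le_trans h2).
    rewrite le_eqVlt; apply/orP; left; apply/eqP.
    rewrite (_ : 4 * expR 3 = expR 3 * 2 * 2 :> R); last by ring.
    by rewrite !exprMn; ring.
  apply: le_trans h2; rewrite sN mulrA ler_wpM2r ?exprn_ge0 ?(ltW s0)//.
  by rewrite -mulrA ler_peMr ?nrm_ge0// mulrC ler_pdivlMr ?sqrt_fact_gt0// mul1r.
by rewrite expr_div_n mulrA ler_pdivlMr// exprn_gt0.
Qed.

Lemma fact_add_le n k (M : nat) : (n + k <= M)%N -> ((n + k)`! <= n`! * M ^ k)%N.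
Proof.
elim: k => [|k IH] nk; first by rewrite addn0 muln1.
rewrite addnS factS expnS mulnCA leq_mul//; first by rewrite -addnS.
by apply: IH; apply: ltnW; rewrite -addnS.
Qed.

Lemma fact_add_ge n k : (n`! * n ^ k <= (n + k)`!)%N.
Proof.
elim: k => [|k IH]; first by rewrite addn0 muln1.
by rewrite addnS factS expnS mulnCA leq_mul// ltnW// ltnS leq_addr.
Qed.

Lemma sqrt_fact_ratio_low n N (x : R) : (n <= N)%N -> (0 < N)%N -> 0 <= x ->
  x ^+ n / sqrt_fact n * (x / Num.sqrt N%:R) ^+ (N - n) <= x ^+ N / sqrt_fact N.
Proof.
move=> nN N0 x0; set s := Num.sqrt N%:R.
have s0 : 0 < s by rewrite sqrtr_gt0 ltr0n.
have h : sqrt_fact N <= sqrt_fact n * s ^+ (N - n).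
  rewrite -ler_sqr ?nnegrE ?mulr_ge0 ?exprn_ge0 ?(ltW (sqrt_fact_gt0 _)) ?(ltW s0)//.
  rewrite exprMn !sqr_sqrt_fact -exprM mulnC exprM sqr_sqrtr// -natrX -natrM ler_nat.
  by have := @fact_add_le n (N - n) N; rewrite subnKC//; exact.
rewrite expr_div_n mulrACA -exprD subnKC// -invfM ler_wpM2l ?exprn_ge0//.
by rewrite lef_pV2 ?posrE ?mulr_gt0 ?exprn_gt0 ?sqrt_fact_gt0.
Qed.

Lemma sqrt_fact_ratio_high n N (x : R) : (N <= n)%N -> (0 < N)%N -> 0 <= x ->
  x ^+ n / sqrt_fact n <= x ^+ N / sqrt_fact N * (x / Num.sqrt N%:R) ^+ (n - N).
Proof.
move=> Nn N0 x0; set s := Num.sqrt N%:R.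
have s0 : 0 < s by rewrite sqrtr_gt0 ltr0n.
have h : sqrt_fact N * s ^+ (n - N) <= sqrt_fact n.
  rewrite -ler_sqr ?nnegrE ?mulr_ge0 ?exprn_ge0 ?(ltW (sqrt_fact_gt0 _)) ?(ltW s0)//.
  rewrite exprMn !sqr_sqrt_fact -exprM mulnC exprM sqr_sqrtr// -natrX -natrM ler_nat.
  by have := @fact_add_ge N (n - N); rewrite subnKC.
rewrite [leRHS]mulrC expr_div_n mulrACA -exprD subnK// -invfM ler_wpM2l ?exprn_ge0//.
rewrite [s ^+ _ * _]mulrC lef_pV2 ?posrE ?mulr_gt0 ?exprn_gt0 ?sqrt_fact_gt0//.
Qed.

(** With q the ratio of the radius of the circle to sqrt N, this size for |a_n|
    makes each of the N terms below index N at most 1 / (16 N) times the term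
    of index N with |a_N| = 1. *)
Definition low_radius (N : nat) (q : R) (n : nat) : R := (16 * N%:R)^-1 * q ^+ (N - n).

Lemma low_radius_itv N q n : (0 < N)%N -> 0 <= q <= 1 -> 0 <= low_radius N q n <= 1.
Proof.
move=> N0 /andP[q0 q1]; have NR : 1 <= N%:R :> R by rewrite ler1n.
have h0 : 0 <= (16 * N%:R : R)^-1 by rewrite invr_ge0; lra.
have h1 : (16 * N%:R : R)^-1 <= 1 by rewrite invf_le1; lra.
have h2 : 0 <= q ^+ (N - n) by rewrite exprn_ge0.
have h3 : q ^+ (N - n) <= 1 by rewrite exprn_ile1.
by rewrite /low_radius mulr_ge0//= mulr_ile1.
Qed.

(** Dominance of the term of index N on the circle of radius r / 2. Halving the
    radius leaves room for the open disk, and only changes the probability by a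
    factor e^O(N^2). *)
Lemma coef_box_has_zeros c N (r : R) : (0 < N)%N -> 0 < r ->
  32 * r <= Num.sqrt N%:R ->
  let q := r / 2 / Num.sqrt N%:R in
  (forall n, (n < N)%N -> nrm (c n) <= low_radius N q n) ->
  4^-1 < nrm (c N) ->
  (forall n, (N < n)%N -> nrm (c n) <= 4 * 2 ^+ (n - N.+1)) ->
  entire (gaf_coef c) /\ has_zeros N r (gaf_coef c).
Proof.
move=> N0 r0; set s := Num.sqrt N%:R => rs q lowc midc highc.
have s0 : 0 < s by rewrite sqrtr_gt0 ltr0n.
have NR : 1 <= N%:R :> R by rewrite ler1n.
have q0 : 0 < q by rewrite /q !divr_gt0.
have q64 : q <= 64^-1.
  by rewrite /q ler_pdivrMr//; lra.
have q1 : q <= 1 by apply: (le_trans q64); lra.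
have low_radius_le1 n : low_radius N q n <= 1.
  by have /andP[] : 0 <= low_radius N q n <= 1 by apply: low_radius_itv; rewrite ?(ltW q0).
have ce : entire (gaf_coef c).
  apply: (@entire_gaf_coef _ (4 + nrm (c N))) => n.
  have p1 : 1 <= 2 ^+ n :> R by rewrite exprn_ege1// ler1n.
  have cN0 := nrm_ge0 (c N).
  have [nN|Nn|nE] := ltngtP n N.
  - by apply: (le_trans (lowc _ nN)); apply: (le_trans (low_radius_le1 n)); nra.
  - apply: (le_trans (highc _ Nn)); apply: (@le_trans _ _ (4 * 2 ^+ n)).
      by rewrite ler_wpM2l// ler_weXn2l ?ler1n// leq_subr.
    by rewrite ler_wpM2r ?(le_trans ler01)// lerDl.
  - rewrite nE in p1 *; apply: (@le_trans _ _ (4 + nrm (c N))); first lra.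
    by rewrite ler_peMr// addr_ge0.
split=> //.
pose x := r / 2; have x0 : 0 < x by rewrite /x divr_gt0.
pose U := x ^+ N / sqrt_fact N; have U0 : 0 < U by rewrite divr_gt0 ?exprn_gt0 ?sqrt_fact_gt0.
have term n : nrm (gaf_coef c n) * x ^+ n = nrm (c n) * (x ^+ n / sqrt_fact n).
  by rewrite nrm_gaf_coef mulrAC mulrA.
(* 3/16 = 1/16 + 1/8: the N lower terms are at most U / (16 N) each, and the
   higher ones sum to at most 8 q U <= U / 8. This is less than |a_N| U as
   |a_N| > 1/4. *)
apply: (@dominant_has_zeros _ N x r (3 / 16 * U)) => //.
- by rewrite x0 /x; lra.
- by rewrite term -/U ltr_pM2r//; lra.
- move=> K.
pose b (n : nat) : R := if (n < N)%N then (16 * N%:R)^-1 else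
    if n == N then 0 else 4 * q * (2 * q) ^+ (n - N.+1).
have b0 i : 0 <= b i.
  have q20 : 0 <= 2 * q by rewrite mulr_ge0// ltW.
  have q40 : 0 <= 4 * q by rewrite mulr_ge0// ltW.
  rewrite /b; case: ifP => _; first by rewrite invr_ge0 mulr_ge0.
  case: ifP => _; first by [].
  by rewrite mulr_ge0// exprn_ge0.
have bn n : n != N -> nrm (gaf_coef c n) * x ^+ n <= b n * U.
  move=> nN'; rewrite term /b; have [nN|Nn|nE] := ltngtP n N.
  + apply: (@le_trans _ _ (low_radius N q n * (x ^+ n / sqrt_fact n))).
      by rewrite ler_wpM2r ?lowc// divr_ge0 ?exprn_ge0 ?(ltW x0) ?(ltW (sqrt_fact_gt0 _)).
    rewrite /low_radius -mulrA ler_wpM2l ?invr_ge0 ?mulr_ge0// mulrC.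
    exact: (sqrt_fact_ratio_low (ltnW nN) N0 (ltW x0)).
  + have h := sqrt_fact_ratio_high (ltnW Nn) N0 (ltW x0).
    apply: le_trans (ler_wpM2l (nrm_ge0 _) h) _.
    rewrite -/U -/s -/q mulrCA [leRHS]mulrC ler_wpM2l ?(ltW U0)//.
    apply: le_trans (ler_wpM2r _ (highc _ Nn)) _; first by rewrite exprn_ge0// ltW.
    have -> : (n - N = (n - N.+1).+1)%N by clear -Nn; lia.
    rewrite [q ^+ _.+1]exprS [(2 * q) ^+ _]exprMn.
    by rewrite le_eqVlt; apply/orP; left; apply/eqP; ring.
  + by rewrite nE eqxx in nN'.
apply: (@le_trans _ _ (\sum_(i < K) b i * U)).
  rewrite [leLHS]big_mkcond /=; apply: ler_sum => i _; case: ifP => [/bn//|_].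
  by rewrite mulr_ge0 ?(ltW U0).
rewrite -mulr_suml ler_wpM2r ?(ltW U0)//.
apply: (@le_trans _ _ (\sum_(i < N.+1 + K) b i)).
  rewrite addnC big_split_ord /= lerDl sumr_ge0//.
rewrite big_split_ord /= big_ord_recr /= {2}/b ltnn eqxx addr0.
have -> : \sum_(i < N) b i = 16^-1.
  rewrite (eq_bigr (fun=> (16 * N%:R)^-1)); last by move=> i _; rewrite /b ltn_ord.
  rewrite sumr_const card_ord -[LHS]mulr_natl invfM mulrCA divff ?mulr1//.
  by rewrite pnatr_eq0 -lt0n.
have -> : \sum_(i < K) b (N.+1 + i)%N = 4 * q * \sum_(0 <= i < K) (2 * q) ^+ i.
  rewrite big_mkord mulr_sumr; apply: eq_bigr => i _.
  rewrite /b ltnNge (leq_trans (leqnSn N) (leq_addr _ _)) /= gtn_eqF; last first.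
    by rewrite addSn ltnS leq_addr.
  by rewrite addKn.
have h : \sum_(0 <= i < K) (2 * q) ^+ i <= 2.
  apply: (le_trans (geo_series_le _ _)); first by apply/andP; split; lra.
  by rewrite invf_ple ?posrE//; lra.
have : 4 * q * \sum_(0 <= i < K) (2 * q) ^+ i <= 4 * q * 2.
  by rewrite ler_wpM2l// mulr_ge0// ltW.
lra.
Qed.

End PlanarSeries.

(** * Probability of overcrowding *)
Section OvercrowdingBounds.
Context (R : realType) (d : measure_display) (T : measurableType d).
Context (P : probability T R) (a : nat -> T -> R[i]).
Hypothesis a_normal : forall n, std_complex_normal P (a n).
Hypothesis a_indep : mutually_independent P a.

Definition overcrowded N (r : R) : set T := [set w | has_zeros N r (gaf_series (a^~ w))].

Lemma measurableCx_gaf_coef n : measurableCx (fun w => gaf_coef (a^~ w) n).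
Proof.
apply: measurableCxM; last exact: measurableCx_cst.
have [m _] := a_normal n; split.
  by apply: (measurableT_comp measurable_fst m).
by apply: (measurableT_comp measurable_snd m).
Qed.

Lemma measurable_overcrowded N (r : R) : 0 < r -> measurable (overcrowded N r).
Proof.
move=> r0; apply: (measurable_has_zeros N r0 (c := fun n w => gaf_series (a^~ w) n)).
- move=> n.
  have mE : measurable_fun setT (fun w => `[< entire (gaf_coef (a^~ w)) >]).
    apply: (measurable_fun_bool true).
    have := measurable_entire measurableCx_gaf_coef; rewrite setTI.
    by congr measurable; apply/seteqP; split => w /= /asboolP.
  have [m1 m2] := measurableCx_gaf_coef n.
  split.
    rewrite (_ : (fun w => _) = (fun w => if `[< entire (gaf_coef (a^~ w)) >]
       then complex.Re (gaf_coef (a^~ w) n) else 0)).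
      by apply: measurable_fun_ifT.
    by apply/funext => w; rewrite /gaf_series; case: ifP.
  rewrite (_ : (fun w => _) = (fun w => if `[< entire (gaf_coef (a^~ w)) >]
     then complex.Im (gaf_coef (a^~ w) n) else 0)).
    by apply: measurable_fun_ifT.
  by apply/funext => w; rewrite /gaf_series; case: ifP.
- by move=> w; exact: entire_gaf_series.
Qed.

Lemma overcrowded_eventE N (r x : R) : N%:R - 1 < x <= N%:R ->
  [set w | (x%:E <= zero_count (planar_gaf (fun n => a n w)) r)%E] = overcrowded N r.
Proof.
move=> xN; apply/seteqP; split => w /=; rewrite /overcrowded /= planar_gafE => h.
  by apply/(zero_count_geP _ (entire_gaf_series _) xN).
by apply/(zero_count_geP _ (entire_gaf_series _) xN).
Qed.

(** Either some |a_n| exceeds e^N 2^n, or all the a_n with n < N are small; in the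
    second case the series is entire, so that convergence needs no separate
    discussion. *)
Lemma prob_overcrowded_ub N (r : R) : (0 < N)%N -> 0 < r -> 2 * r <= Num.sqrt N%:R ->
  (P (overcrowded N r) <= (4 * expR (- (expR N%:R ^+ 2 / 2)) +
    \prod_(n <- iota 0 N) (4 * ((4 * expR 3) ^+ N * (r / Num.sqrt N%:R) ^+ (N - n)) ^+ 2))%:E)%E.
Proof.
move=> N0 r0 rs.
pose t n := (4 * expR 3 : R) ^+ N * (r / Num.sqrt N%:R) ^+ (N - n).
have t0 n : 0 <= t n.
  by rewrite mulr_ge0 ?exprn_ge0 ?mulr_ge0 ?expR_ge0 ?invr_ge0 ?sqrtr_ge0 ?(ltW r0).
have K0 : 0 <= expR N%:R :> R by exact: expR_ge0.
have K2 : expR (- (expR N%:R ^+ 2 / 2)) <= 2^-1 :> R.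
  rewrite expRN lef_pV2 ?posrE ?expR_gt0//.
  apply: le_trans (expR_ge1Dx _).
  have h1 : 2 <= expR N%:R :> R.
    apply: le_trans (expR_ge1Dx _); have : 1 <= N%:R :> R by rewrite ler1n.
    lra.
  nra.
pose V := \bigcup_n [set w | (~` disk (expR N%:R * 2 ^+ n)) (to_plane (a n w))].
pose W := \bigcap_(n in [set` iota 0 N]) [set w | disk (t n) (to_plane (a n w))].
have mV : measurable V.
  apply: bigcup_measurable => n _; apply: (measurable_coef a_normal).
  by apply: measurableC; exact: measurable_disk.
have mW : measurable W.
  exact: (@measurable_coef_bigcap _ _ _ _ _ a_normal (iota 0 N)
    (fun n => disk (t n)) (fun n => @measurable_disk R (t n))).
apply: (@le_trans _ _ (P (V `|` W))).
  apply: le_measure; rewrite ?inE; [exact: measurable_overcrowded|exact: measurableU|].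
  move=> w h; have [Vw|nV] := pselect (V w); [by left|right].
  have aw n : nrm (a n w) <= expR N%:R * 2 ^+ n.
    have K2n : 0 <= expR N%:R * 2 ^+ n :> R by rewrite mulr_ge0// exprn_ge0.
    apply/(disk_nrm _ K2n); apply: contrapT => hn; apply: nV.
    by exists n.
  move: h; rewrite /overcrowded /= gaf_seriesE; last exact: entire_gaf_coef aw.
  move=> h n nN; apply/(disk_nrm _ (t0 n)).
  apply: (overcrowded_coef_le N0 r0 rs aw h).
  by have : n \in iota 0 N by []; rewrite mem_iota add0n.
apply: le_trans (measureU2 _ mV mW) _.
rewrite EFinD; apply: leeD.
  exact: (prob_union_tail a_normal).
exact: (prob_indep_ub a_normal a_indep).
Qed.

Lemma prob_overcrowded_lb N (r : R) : (0 < N)%N -> 0 < r -> 32 * r <= Num.sqrt N%:R ->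
  ((4^-1 * \prod_(n <- iota 0 N)
     (gauss_const R * low_radius N (r / 2 / Num.sqrt N%:R) n ^+ 2))%:E <= P (overcrowded N r))%E.
Proof.
move=> N0 r0 rs; set q := r / 2 / Num.sqrt N%:R.
have s0 : 0 < Num.sqrt N%:R :> R by rewrite sqrtr_gt0 ltr0n.
have q0 : 0 <= q by rewrite !divr_ge0// ltW.
have q1 : q <= 1 by rewrite /q ler_pdivrMr// mul1r; lra.
have t01 n : 0 <= low_radius N q n <= 1 by apply: low_radius_itv; rewrite ?q0.
apply: le_trans (prob_coef_box_lb a_normal a_indep N t01) _.
apply: le_measure; rewrite ?inE.
- apply: bigcapT_measurable => n; apply: (measurable_coef a_normal).
  exact: measurable_coef_box.
- exact: measurable_overcrowded.
move=> w Gw.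
have [|||ce hz] := @coef_box_has_zeros R (a^~ w) N r N0 r0 rs; last first.
- by rewrite /overcrowded /= gaf_seriesE.
- move=> n Nn; have p0 : 0 <= 4 * 2 ^+ (n - N.+1) :> R by rewrite mulr_ge0// exprn_ge0.
  apply/(disk_nrm _ p0); have := Gw n Logic.I; rewrite /= /coef_box.
  by rewrite ltnNge (ltnW Nn) /= gtn_eqF.
- have p0 : 0 <= 4^-1 :> R by rewrite invr_ge0.
  rewrite ltNge; apply/negP => /(disk_nrm _ p0) h.
  by have := Gw N Logic.I; rewrite /= /coef_box ltnn eqxx; apply.
- move=> n nN; have /andP[p0 _] := t01 n.
  by apply/(disk_nrm _ p0); have := Gw n Logic.I; rewrite /= /coef_box nN.
Qed.

End OvercrowdingBounds.

Section ExponentialForm.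
Context (R : realType) (d : measure_display) (T : measurableType d).
Context (P : probability T R) (a : nat -> T -> R[i]).
Hypothesis a_normal : forall n, std_complex_normal P (a n).
Hypothesis a_indep : mutually_independent P a.

Lemma prod_expR_iota N (u v : R) :
  \prod_(n <- iota 0 N) expR (u + (N - n)%:R * v) =
  expR (N%:R * u + N%:R * (N%:R + 1) / 2 * v).
Proof.
elim: N => [|N IH]; first by rewrite big_nil !mul0r addr0 expR0.
rewrite /= big_cons subn0 -[1%N]addn0 iotaDl big_map.
under eq_bigr do rewrite add1n subSS.
by rewrite IH -expRD; congr expR; rewrite -natr1; field.
Qed.

Lemma ln_le_sub1 (x : R) : 0 < x -> ln x <= x - 1.
Proof.
move=> x0; have h := @le_ln1Dx R (x - 1).
by rewrite [1 + _]addrC subrK in h; apply: h; lra.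
Qed.

(** What is needed of N and r once N is much larger than r^2, in terms of
    L = ln (N / r^2). *)
Lemma regime_facts (N : nat) (r : R) : 1 <= r -> 32 * r <= Num.sqrt N%:R ->
  [/\ 32 <= N%:R :> R, 0 <= ln (N%:R / r ^+ 2), ln (N%:R / r ^+ 2) <= N%:R &
      r / Num.sqrt N%:R = expR (- (ln (N%:R / r ^+ 2) / 2))].
Proof.
set s := Num.sqrt N%:R; set L := ln _ => r1 rs.
have s_sqr : s ^+ 2 = N%:R by rewrite sqr_sqrtr.
have s32 : 32 <= s by lra.
have NN : 32 <= N%:R :> R by rewrite -s_sqr expr2; nra.
have r2 : 1 <= r ^+ 2 by rewrite expr_ge1//; lra.
have q0 : 0 < N%:R / r ^+ 2 by rewrite divr_gt0//; lra.
split=> //.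
- apply: ln_ge0; rewrite ler_pdivlMr ?mul1r -?s_sqr; last by lra.
  by rewrite ler_sqr ?nnegrE; lra.
- apply: (le_trans (ltW (ln_sublinear q0))).
  by rewrite ler_pdivrMr ?ler_peMr//; lra.
apply/eqP; rewrite -(@eqrXn2 _ 2)// ?divr_ge0 ?expR_ge0//; [|lra|lra].
rewrite -expRM_natl mulrN mulrCA divff// mulr1 /L expRN lnK ?posrE//.
by rewrite invf_div expr_div_n s_sqr.
Qed.

Definition ln_ub_base : R := ln (4 * expR 3).
(** The constant of the O(N^2) error term in the upper bound; [lb_const] is the
    one of the lower bound. *)
Definition ub_const : R := 1 + ln 4 + 2 * ln_ub_base.

(** The product of the N small probabilities has exponent
    - N (N + 1) L / 2 + O(N^2). The probability that some coefficient is huge is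
    smaller than this because e^(2N) outgrows N^3 >= N^2 L. *)
Lemma overcrowded_expR_ub (N : nat) (r : R) : 1 <= r -> 32 * r <= Num.sqrt N%:R ->
  (P (overcrowded a N r) <=
   (expR (- (N%:R ^+ 2 / 2 * ln (N%:R / r ^+ 2) - ub_const * N%:R ^+ 2)))%:E)%E.
Proof.
move=> r1 rN; have [NN L_ge0 L_leN rsE] := regime_facts r1 rN; move: rN L_ge0 L_leN rsE.
set s := Num.sqrt N%:R; set L := ln (_ / _) => rN L_ge0 L_leN rsE.
have N_gt0 : (0 < N)%N by rewrite -(ltr_nat R); lra.
have r_gt0 : 0 < r by lra.
have A1 : 1 <= 4 * expR 3 :> R.
  by have := expR_ge1Dx (3 : R); lra.
have lnA0 : 0 <= ln_ub_base by exact: ln_ge0.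
have ln40 : 0 <= ln 4 :> R by apply: ln_ge0; lra.
have ln43 : ln 4 <= 3 :> R by apply: le_trans (ln_le_sub1 _) _ => //; lra.
apply: le_trans (prob_overcrowded_ub a_normal a_indep N_gt0 r_gt0 _) _.
  by rewrite -/s; lra.
rewrite lee_fin -/s.
pose E := expR ((ln 4 + 2 * ln_ub_base) * N%:R ^+ 2 - N%:R ^+ 2 / 2 * L).
have h1 : \prod_(n <- iota 0 N) (4 * ((4 * expR 3) ^+ N * (r / s) ^+ (N - n)) ^+ 2) <= E.
  rewrite (eq_bigr (fun n => expR ((ln 4 + 2 * N%:R * ln_ub_base) + (N - n)%:R * (- L)))); last first.
    move=> n _; rewrite [RHS]expRD [expR (ln 4 + _)]expRD lnK ?posrE// -[RHS]mulrA.
    congr (_ * _); rewrite exprMn rsE -!expRM_natl; congr (_ * _).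
      rewrite -(lnK (x := 4 * expR 3)) ?posrE; last by lra.
      by rewrite -!expRM_natl mulrA.
    by congr expR; field.
  rewrite prod_expR_iota ler_expR.
  have N1 : N%:R <= N%:R ^+ 2 :> R by rewrite expr2; nra.
  have : ln 4 * N%:R <= ln 4 * N%:R ^+ 2 :> R by apply: ler_wpM2l.
  have : 0 <= N%:R / 2 * L by rewrite mulr_ge0.
  lra.
have h2 : 4 * expR (- (expR N%:R ^+ 2 / 2)) <= E.
  rewrite -{1}(lnK (x := 4)) ?posrE// -expRD ler_expR.
  (* e^(2N) is compared with N^3 through its Taylor term of degree 4. *)
  have h3 : (2 * N%:R) ^+ 4 / 24 <= expR N%:R ^+ 2 :> R.
    rewrite -expRM_natl; have := @expR_ge1Dxn R (2 * N%:R) 3.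
    have -> : (4`!)%:R = 24 :> R by [].
    by move=> /(_ _); rewrite mulr_ge0// => /(_ isT); lra.
  have h4 : N%:R ^+ 2 / 2 * L <= N%:R ^+ 3 / 2.
    have -> : N%:R ^+ 3 / 2 = N%:R ^+ 2 / 2 * N%:R :> R by ring.
    by rewrite ler_wpM2l// divr_ge0// exprn_ge0.
  have h5 : 0 <= (ln 4 + 2 * ln_ub_base) * N%:R ^+ 2 by rewrite mulr_ge0 ?exprn_ge0//; lra.
  have h6 : 32 * N%:R ^+ 3 <= N%:R ^+ 4 :> R by rewrite [leRHS]exprS ler_wpM2r ?exprn_ge0.
  have h7 : 32 <= N%:R ^+ 3 :> R.
    by apply: (le_trans NN); rewrite exprS ler_peMr// expr_ge1//; lra.
  have e4 : (2 * N%:R) ^+ 4 / 24 = N%:R ^+ 4 * (2 / 3) :> R by field.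
  lra.
apply: (le_trans (lerD h2 h1)).
have : expR 1 * E <= expR (- (N%:R ^+ 2 / 2 * L - ub_const * N%:R ^+ 2)).
  rewrite /E -expRD ler_expR /ub_const.
  have N1 : 1 <= N%:R ^+ 2 :> R by rewrite expr_ge1//; lra.
  lra.
apply: le_trans; have := expR_ge1Dx (1 : R); have := expR_gt0 ((ln 4 + 2 * ln_ub_base) * N%:R ^+ 2 - N%:R ^+ 2 / 2 * L).
rewrite -/E; nra.
Qed.

Definition lb_const : R := 39 + `|ln (gauss_const R)|.

(** The factors 1 / (16 N)^2, N in number, contribute O(N ln N) to the exponent,
    which is absorbed in the O(N^2). *)
Lemma overcrowded_expR_lb (N : nat) (r : R) : 1 <= r -> 32 * r <= Num.sqrt N%:R ->
  ((expR (- (N%:R ^+ 2 / 2 * ln (N%:R / r ^+ 2) + lb_const * N%:R ^+ 2)))%:E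
   <= P (overcrowded a N r))%E.
Proof.
move=> r1 rN; have [NN L_ge0 L_leN rsE] := regime_facts r1 rN; move: rN L_ge0 L_leN rsE.
set s := Num.sqrt N%:R; set L := ln (_ / _) => rN L_ge0 L_leN rsE.
have N_gt0 : (0 < N)%N by rewrite -(ltr_nat R); lra.
have r_gt0 : 0 < r by lra.
apply: le_trans (prob_overcrowded_lb a_normal a_indep N_gt0 r_gt0 rN).
rewrite lee_fin -/s.
have ln40 : 0 <= ln 4 :> R by apply: ln_ge0; lra.
have ln43 : ln 4 <= 3 :> R by apply: le_trans (ln_le_sub1 _) _ => //; lra.
have N16 : 0 < 16 * N%:R :> R by lra.
have cg0 := gauss_const_gt0 R.
rewrite (eq_bigr (fun n => expR ((ln (gauss_const R) - 2 * ln (16 * N%:R)) +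
   (N - n)%:R * (- (L + ln 4))))); last first.
  move=> n _; rewrite [RHS]expRD [expR (ln _ - _)]expRD lnK ?posrE// -[RHS]mulrA.
  congr (_ * _).
  rewrite /low_radius exprMn; congr (_ * _).
    by rewrite exprVn expRN expRM_natl lnK ?posrE.
  have -> : r / 2 / s = expR (- (L / 2)) / 2 by rewrite -rsE mulrAC.
  have e2 : expR (ln 4 / 2) = 2 :> R.
    apply/eqP; rewrite -(@eqrXn2 _ 2)// ?expR_ge0//.
    rewrite -expRM_natl mulrCA divff// mulr1 lnK ?posrE//.
    by apply/eqP; ring.
  by rewrite -{2}e2 -expRN -expRD -!expRM_natl; congr expR; field.
rewrite prod_expR_iota -{1}(lnK (x := 4^-1)) ?posrE ?invr_gt0// -expRD ler_expR.
rewrite lnV ?posrE//.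
have h1 : ln (16 * N%:R) <= 16 * N%:R :> R by apply/ltW/ln_sublinear.
have N1 : N%:R <= N%:R ^+ 2 :> R by rewrite expr2; nra.
have N2 : 1 <= N%:R ^+ 2 :> R by lra.
have h2 : N%:R * ln (16 * N%:R) <= 16 * N%:R ^+ 2 :> R.
  have -> : 16 * N%:R ^+ 2 = N%:R * (16 * N%:R) :> R by ring.
  by rewrite ler_wpM2l.
have h3 : - (N%:R * ln (gauss_const R)) <= `|ln (gauss_const R)| * N%:R ^+ 2.
  rewrite -mulrN; apply: (@le_trans _ _ (N%:R * `|ln (gauss_const R)|)).
    by rewrite ler_wpM2l// -normrN ler_norm.
  by rewrite mulrC ler_wpM2l.
have h4 : N%:R * L <= N%:R ^+ 2 by rewrite expr2 ler_wpM2l.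
have h5 : N%:R * (N%:R + 1) / 2 * ln 4 <= 3 * N%:R ^+ 2 :> R.
  apply: (@le_trans _ _ (N%:R * (N%:R + 1) / 2 * 3)).
    by rewrite ler_wpM2l// divr_ge0// mulr_ge0// addr_ge0.
  lra.
rewrite /lb_const; lra.
Qed.

End ExponentialForm.

(** * Asymptotics of the exponent *)
Section Asymptotics.
Variable R : realType.

Definition nat_ceil (x : R) : nat :=
  if (Num.truncn x)%:R == x then Num.truncn x else (Num.truncn x).+1.

Lemma nat_ceil_itv (x : R) : 0 <= x -> (nat_ceil x)%:R - 1 < x <= (nat_ceil x)%:R.
Proof.
move=> x0; have /andP[h1 h2] := truncn_itv x0.
rewrite /nat_ceil; case: eqVneq => [->|ne]; first by rewrite lexx andbT ltrBlDr ltrDl.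
by rewrite (ltW h2) andbT -natr1 addrK lt_neqAle ne.
Qed.

Lemma ln_pinfty : @ln R r @[r --> +oo%R] --> +oo%R.
Proof.
apply/cvgryPge => A; near=> r.
have rA : expR A <= r by near: r; apply: nbhs_pinfty_ge; exact: num_real.
have r0 : 0 < r := lt_le_trans (expR_gt0 A) rA.
by rewrite -(expRK A) ler_ln ?posrE ?expR_gt0.
Unshelve. all: by end_near. Qed.

Lemma inv_ln_cvg0 : (ln r)^-1 @[r --> +oo%R] --> (0 : R).
Proof.
apply/gtr0_cvgV0; last exact: ln_pinfty.
near=> r; apply: ln_gt0; near: r; apply: nbhs_pinfty_gt; exact: num_real.
Unshelve. all: by end_near. Qed.

Variables (alpha gamma : R).
Hypotheses (alpha_gt2 : 2 < alpha) (gamma_gt0 : 0 < gamma).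

Lemma sqr_div_powR_cvg0 : r ^+ 2 / r `^ alpha @[r --> +oo%R] --> (0 : R).
Proof.
have b0 : 0 < alpha - 2 by rewrite subr_gt0.
have h : (alpha - 2)^-1 * (ln r)^-1 @[r --> +oo%R] --> ((alpha - 2)^-1 * 0 : R).
  by apply: cvgMr; exact: inv_ln_cvg0.
rewrite mulr0 in h.
apply: (@squeeze_cvgr _ _ _ _ (cst 0) (fun r => (alpha - 2)^-1 * (ln r)^-1));
  [|exact: cvg_cst|exact: h].
near=> r; have r1 : 1 < r by near: r; apply: nbhs_pinfty_gt; exact: num_real.
have r0 : 0 < r by apply: lt_trans r1.
have lr : 0 < ln r by exact: ln_gt0.
rewrite /= divr_ge0 ?powR_ge0 ?sqr_ge0//=.
rewrite -powR_mulrn ?(ltW r0)// -powRN -powRD ?(gt_eqF r0) ?implybT//.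
have -> : r `^ (2 - alpha) = (expR ((alpha - 2) * ln r))^-1.
  by rewrite /powR (gt_eqF r0) -expRN -mulNr opprB.
rewrite -invfM lef_pV2 ?posrE ?expR_gt0 ?mulr_gt0//.
by apply: le_trans (expR_ge1Dx _); rewrite lerDr.
Unshelve. all: by end_near. Qed.

Lemma inv_powR_cvg0 : (r `^ alpha)^-1 @[r --> +oo%R] --> (0 : R).
Proof.
apply: (@squeeze_cvgr _ _ _ _ (cst 0) (fun r => r ^+ 2 / r `^ alpha));
  [|exact: cvg_cst|exact: sqr_div_powR_cvg0].
near=> r; have r1 : 1 < r by near: r; apply: nbhs_pinfty_gt; exact: num_real.
by rewrite /= invr_ge0 powR_ge0 /= ler_peMl ?invr_ge0 ?powR_ge0// expr_ge1// ltW// (lt_trans _ r1).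
Unshelve. all: by end_near. Qed.

Definition threshold (r : R) : R := r ^+ 2 + gamma * r `^ alpha.
Definition zero_nb (r : R) : R := (nat_ceil (threshold r))%:R.

Lemma threshold_ge0 r : 0 <= threshold r.
Proof. by rewrite addr_ge0 ?sqr_ge0// mulr_ge0 ?powR_ge0// ltW. Qed.

Lemma zero_nb_cvg : zero_nb r / r `^ alpha @[r --> +oo%R] --> gamma.
Proof.
have h1 : r ^+ 2 / r `^ alpha + gamma @[r --> +oo%R] --> (0 + gamma : R).
  by apply: cvgD; [exact: sqr_div_powR_cvg0|exact: cvg_cst].
have h2 : r ^+ 2 / r `^ alpha + gamma + (r `^ alpha)^-1 @[r --> +oo%R] --> (0 + gamma + 0 : R).
  by apply: cvgD; [exact: h1|exact: inv_powR_cvg0].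
rewrite add0r in h1; rewrite add0r addr0 in h2.
apply: (squeeze_cvgr _ h1 h2).
near=> r; have r0 : 0 < r by near: r; apply: nbhs_pinfty_gt; exact: num_real.
have V0 : 0 < r `^ alpha by exact: powR_gt0.
have /andP[n1 n2] := nat_ceil_itv (threshold_ge0 r); rewrite -/(zero_nb r) in n1 n2.
have E : r ^+ 2 / r `^ alpha + gamma = threshold r / r `^ alpha.
  by rewrite /threshold mulrDl mulfK// gt_eqF.
rewrite E -[X in _ + X]mul1r -mulrDl !ler_pM2r ?invr_gt0// n2 /=.
by rewrite ltW// -ltrBlDr.
Unshelve. all: by end_near. Qed.

Definition log_gap (r : R) : R := ln (zero_nb r / r ^+ 2).
Definition rate (r : R) : R := (alpha / 2 - 1) * gamma ^+ 2 * r `^ (2 * alpha) * ln r.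

Lemma log_gap_cvg : log_gap r / ln r @[r --> +oo%R] --> alpha - 2.
Proof.
have h : ln (zero_nb r / r `^ alpha) * (ln r)^-1 + (alpha - 2) @[r --> +oo%R] -->
    (ln gamma * 0 + (alpha - 2) : R).
  apply: cvgD; last exact: cvg_cst.
  apply: cvgM; last exact: inv_ln_cvg0.
  apply: (continuous_cvg _ _ zero_nb_cvg); exact: continuous_ln.
rewrite mulr0 add0r in h; apply: cvg_trans h; apply: near_eq_cvg.
near=> r; have r1 : 1 < r by near: r; apply: nbhs_pinfty_gt; exact: num_real.
have r0 : 0 < r by apply: lt_trans r1.
have V0 : 0 < r `^ alpha by exact: powR_gt0.
have lr : 0 < ln r by exact: ln_gt0.
have N0 : 0 < zero_nb r.
  have /andP[_ n2] := nat_ceil_itv (threshold_ge0 r); apply: lt_le_trans n2.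
  by rewrite /threshold ltr_wpDl ?sqr_ge0// mulr_gt0.
rewrite /log_gap !ln_div ?posrE ?exprn_gt0// lnXn// ln_powR -mulr_natl.
by field; rewrite gt_eqF.
Unshelve. all: by end_near. Qed.

Let rate_const : R := (alpha / 2 - 1) * gamma ^+ 2.

Lemma rate_const_gt0 : 0 < rate_const.
Proof. by rewrite /rate_const mulr_gt0 ?exprn_gt0// subr_gt0 ltr_pdivlMr// mul1r. Qed.

Lemma rateE r : rate r = rate_const * (r `^ alpha) ^+ 2 * ln r.
Proof. by rewrite /rate [2 * alpha]mulrC powRrM powR_mulrn ?powR_ge0. Qed.

(** N ~ gamma r^alpha and L ~ (alpha - 2) ln r. *)
Lemma main_term_cvg : zero_nb r ^+ 2 / 2 * log_gap r / rate r @[r --> +oo%R] --> (1 : R).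
Proof.
have h : (zero_nb r / r `^ alpha) ^+ 2 * (log_gap r / ln r) * (2 * rate_const)^-1 @[r --> +oo%R] -->
    (gamma ^+ 2 * (alpha - 2) * (2 * rate_const)^-1 : R).
  apply: cvgMl; apply: cvgM; last exact: log_gap_cvg.
  by rewrite !expr2; under eq_fun do rewrite expr2; apply: cvgM; exact: zero_nb_cvg.
have e1 : gamma ^+ 2 * (alpha - 2) * (2 * rate_const)^-1 = 1.
  by rewrite /rate_const; field; rewrite !gt_eqF//= subr_gt0.
rewrite e1 in h; apply: cvg_trans h; apply: near_eq_cvg.
near=> r; have r1 : 1 < r by near: r; apply: nbhs_pinfty_gt; exact: num_real.
have r0 : 0 < r by apply: lt_trans r1.
have V0 : 0 < r `^ alpha by exact: powR_gt0.
have lr : 0 < ln r by exact: ln_gt0.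
have k0 := rate_const_gt0; rewrite rateE; field.
by rewrite !gt_eqF.
Unshelve. all: by end_near. Qed.

(** The rate has an extra factor ln r over N^2. *)
Lemma error_term_cvg : zero_nb r ^+ 2 / rate r @[r --> +oo%R] --> (0 : R).
Proof.
have h : (zero_nb r / r `^ alpha) ^+ 2 * rate_const^-1 * (ln r)^-1 @[r --> +oo%R] -->
    (gamma ^+ 2 * rate_const^-1 * 0 : R).
  apply: cvgM; last exact: inv_ln_cvg0.
  apply: cvgMl; rewrite !expr2; under eq_fun do rewrite expr2.
  by apply: cvgM; exact: zero_nb_cvg.
rewrite mulr0 in h; apply: cvg_trans h; apply: near_eq_cvg.
near=> r; have r1 : 1 < r by near: r; apply: nbhs_pinfty_gt; exact: num_real.
have r0 : 0 < r by apply: lt_trans r1.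
have V0 : 0 < r `^ alpha by exact: powR_gt0.
have lr : 0 < ln r by exact: ln_gt0.
have k0 := rate_const_gt0; rewrite rateE; field.
by rewrite !gt_eqF.
Unshelve. all: by end_near. Qed.

Lemma regime_near : \forall r \near +oo%R, 32 * r <= Num.sqrt (zero_nb r).
Proof.
have g := gamma_gt0; have g0 : 0 < gamma / 1024 by lra.
near=> r; have r1 : 1 < r by near: r; apply: nbhs_pinfty_gt; exact: num_real.
have r0 : 0 < r by apply: lt_trans r1.
have V0 : 0 < r `^ alpha by exact: powR_gt0.
have h : r ^+ 2 / r `^ alpha < gamma / 1024.
  near: r; exact: (cvgr_lt _ sqr_div_powR_cvg0 _ g0).
rewrite ltr_pdivrMr// in h.
have /andP[_ n2] := nat_ceil_itv (threshold_ge0 r); rewrite -/(zero_nb r) in n2.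
have N0 : 0 <= zero_nb r by [].
rewrite -ler_sqr ?nnegrE ?sqrtr_ge0 ?mulr_ge0 ?(ltW r0)// sqr_sqrtr//.
apply: le_trans n2; rewrite /threshold exprMn.
have : 0 <= r ^+ 2 by exact: sqr_ge0.
have -> : (32 : R) ^+ 2 = 1024 by ring.
lra.
Unshelve. all: by end_near. Qed.

End Asymptotics.

Theorem theorem3 (R : realType) (d : measure_display) (T : measurableType d)
    (P : probability T R) (a : nat -> T -> R[i])
    (a_normal : forall n : nat, std_complex_normal P (a n))
    (a_indep : mutually_independent P a)
    (alpha gamma : R) (alpha_gt2 : 2 < alpha) (gamma_gt0 : 0 < gamma) :
  exists eps : R -> R,
    eps r @[r --> +oo] --> 0 /\
    \forall r \near +oo,
      P [set w | ((r ^+ 2 + gamma * r `^ alpha)%:E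
                    <= zero_count (planar_gaf (fun n => a n w)) r)%E] =
      (expR (- ((alpha / 2 - 1) * gamma ^+ 2 * r `^ (2 * alpha) * ln r
                * (1 + eps r))))%:E.
Proof.
pose N r := nat_ceil (threshold alpha gamma r).
pose p r := fine (P (overcrowded a (N r) r)).
pose eps r := - ln (p r) / rate alpha gamma r - 1.
have itv r := nat_ceil_itv (threshold_ge0 alpha gamma_gt0 r).
pose C := ub_const R + lb_const R.
have C1 : 0 <= ub_const R.
  rewrite /ub_const /ln_ub_base !addr_ge0 ?ln_ge0 ?mulr_ge0 ?ln_ge0//; first by lra.
  by have := expR_ge1Dx (3 : R); lra.
have C2 : 0 <= lb_const R by rewrite /lb_const addr_ge0.
have bounds : \forall r \near +oo%R, [/\ 0 < p r, 0 < rate alpha gamma r &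
    `|eps r| <= `|zero_nb alpha gamma r ^+ 2 / 2 * log_gap alpha gamma r / rate alpha gamma r - 1| +
      C * (zero_nb alpha gamma r ^+ 2 / rate alpha gamma r)].
  near=> r; have r1 : 1 < r by near: r; apply: nbhs_pinfty_gt; exact: num_real.
  have r0 : 0 < r by apply: lt_trans r1.
  have rN : 32 * r <= Num.sqrt (N r)%:R by near: r; exact: regime_near.
  have mE : measurable (overcrowded a (N r) r) by exact: (measurable_overcrowded a_normal).
  have pE : P (overcrowded a (N r) r) = (p r)%:E by rewrite fineK// fin_num_measure.
  have ub := overcrowded_expR_ub a_normal a_indep (ltW r1) rN.
  have lb := overcrowded_expR_lb a_normal a_indep (ltW r1) rN.
  rewrite pE lee_fin in ub; rewrite pE lee_fin in lb.
  have p0 : 0 < p r by apply: lt_le_trans lb; exact: expR_gt0.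
  have t0 : 0 < rate alpha gamma r.
    rewrite rateE; apply: mulr_gt0; last exact: ln_gt0.
    by apply: mulr_gt0; [exact: rate_const_gt0|rewrite exprn_gt0// powR_gt0].
  split=> //.
  rewrite -ler_ln ?posrE ?expR_gt0// expRK in ub.
  rewrite -ler_ln ?posrE ?expR_gt0// expRK in lb.
  rewrite -/(zero_nb alpha gamma r) -/(log_gap alpha gamma r) in ub lb.
  set n2 := zero_nb alpha gamma r ^+ 2 in ub lb *; set L := log_gap alpha gamma r in ub lb *.
  set t := rate alpha gamma r in t0 *.
  have n20 : 0 <= n2 by exact: sqr_ge0.
  have -> : eps r = (n2 / 2 * L / t - 1) + (- ln (p r) - n2 / 2 * L) / t.
    by rewrite /eps -/t mulrBl; ring.
  apply: (le_trans (ler_normD _ _)); rewrite lerD2l normrM (gtr0_norm (x := t^-1)) ?invr_gt0//.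
  rewrite mulrA ler_wpM2r ?invr_ge0 ?(ltW t0)// ler_norml /C.
  have a1 : 0 <= ub_const R * n2 by rewrite mulr_ge0.
  have a2 : 0 <= lb_const R * n2 by rewrite mulr_ge0.
  by apply/andP; split; lra.
exists eps; split.
  apply/norm_cvg0P.
  have h : `|zero_nb alpha gamma r ^+ 2 / 2 * log_gap alpha gamma r / rate alpha gamma r - 1| +
      C * (zero_nb alpha gamma r ^+ 2 / rate alpha gamma r) @[r --> +oo%R] --> (0 + C * 0 : R).
    apply: cvgD.
      by apply/norm_cvg0P; apply/subr_cvg0; exact: main_term_cvg.
    by apply: cvgMr; exact: error_term_cvg.
  rewrite mulr0 addr0 in h.
  apply: (@squeeze_cvgr _ _ _ _ (cst 0) (fun r =>
    `|zero_nb alpha gamma r ^+ 2 / 2 * log_gap alpha gamma r / rate alpha gamma r - 1| +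
      C * (zero_nb alpha gamma r ^+ 2 / rate alpha gamma r))); [|exact: cvg_cst|exact: h].
  by apply: filterS bounds => r [_ _ er]; rewrite normr_ge0.
have r_pos : \forall r \near +oo%R, (0 : R) < r.
  by apply: nbhs_pinfty_gt; exact: num_real.
apply: filterS2 bounds r_pos => r [p0 t0 _] r0.
rewrite (overcrowded_eventE a r (itv r)) -/(N r).
rewrite -[LHS]fineK; last by rewrite fin_num_measure//; exact: (measurable_overcrowded a_normal).
congr EFin; rewrite -/(p r) -/(rate alpha gamma r) /eps addrC subrK.
by rewrite mulrC divfK ?gt_eqF// opprK lnK ?posrE.
Unshelve. all: by end_near. Qed.
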